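(* Let $\mathcal{S}$ denote the support of the law of the $C([0,1])$-valued random variable $$\mathrm{K}(t)=t\,\mathrm{ST}_0+\sum_{h\neq 0}\frac{e(ht)-1}{2\pi i h}\mathrm{ST}_h,\qquad 0\le t\le 1.$$ Then $\mathcal{S}$ is exactly the set of all $f\in C([0,1])$ such that $f(0)=0$, $f(1)\in[-2,2]$, and such that the function $g(t)=f(t)-tf(1)$ satisfies, for every non-zero integer $h$, $$\widehat{g}(h)\in i\mathbf{R}\quad\text{and}\quad |\widehat{g}(h)|\le \frac{1}{\pi|h|},$$ where $\widehat{g}(h)=\int_0^1 g(t)e(-ht)\,dt$.
   Context: $e(z)=e^{2i\pi z}$. $C([0,1])$ is the Banach space of continuous complex-valued functions on $[0,1]$ with the sup norm. $(\mathrm{ST}_h)_{h\in\mathbf{Z}}$ is a family of independent real random variables, each with the Sato–Tate law $\frac{1}{\pi}\sqrt{1-\frac{x^2}{4}}\,dx$ on $[-2,2]$; the series defining $\mathrm{K}$ converges almost surely uniformly on $[0,1]$ in the sense of symmetric partial sums (over $|h|\le N$, $N\to\infty$), so $\mathrm{K}$ is a $C([0,1])$-valued random variable. The support of its law is the set of $f\in C([0,1])$ such that every open neighbourhood of $f$ has positive probability. *)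

(* Defs.v *)
From HB Require Import structures.
From mathcomp Require Import all_boot all_order all_algebra.
From mathcomp Require Import all_classical all_reals all_analysis.
From mathcomp Require Import complex.

Set Implicit Arguments.
Unset Strict Implicit.
Unset Printing Implicit Defensive.

Import Order.TTheory GRing.Theory Num.Theory.
Import numFieldNormedType.Exports numFieldTopology.Exports.

Local Open Scope classical_set_scope.
Local Open Scope ring_scope.
Local Open Scope complex_scope.

Definition ee {R : realType} (x : R) : R[i] :=
  (cos (2 * pi * x)) +i* (sin (2 * pi * x)).

Definition fourier_coef {R : realType} (g : R -> R[i]) (h : int) : R[i] :=
  (Rintegral lebesgue_measure `[0%R, 1%R]
     (fun t => complex.Re (g t * ee (- (h%:~R * t))))) +i*
  (Rintegral lebesgue_measure `[0%R, 1%R]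
     (fun t => complex.Im (g t * ee (- (h%:~R * t))))).

Definition mutually_independent {d : measure_display} {T : measurableType d}
  {R : realType} (P : probability T R) (X : int -> T -> R) : Prop :=
  forall (J : seq int) (B : int -> set R),
    uniq J -> (forall j, measurable (B j)) ->
    P (\big[setI/setT]_(j <- J) (X j @^-1` B j)) =
    (\prod_(j <- J) P (X j @^-1` B j))%E.

Definition sato_tate_law {d : measure_display} {T : measurableType d}
  {R : realType} (P : probability T R) (X : T -> R) : Prop :=
  forall A : set R, measurable A ->
    P (X @^-1` A) =
    (\int[lebesgue_measure]_(x in A `&` `[(-2)%R, 2%R])
       ((Num.sqrt (1 - x ^+ 2 / 4)) / pi)%:E)%E.

Definition K_partial {T : Type} {R : realType} (ST : int -> T -> R)
  (N : nat) (w : T) (t : R) : R[i] :=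
  let term (h : int) : R[i] :=
    (ee (h%:~R * t) - 1) / ((2 * pi * h%:~R)%:C * 'i) * (ST h w)%:C in
  (t * ST 0 w)%:C + \sum_(1 <= n < N.+1) (term (Posz n) + term (- Posz n)).

(* The sup-norm ball of radius eps around f in C([0,1]) (restricted to [0,1]);
   continuous functions on [0,1] attain their sup, so for continuous k, f this
   is exactly  sup_{[0,1]} |k - f| < eps. *)
Definition sup_ball {R : realType} (f : R -> R[i]) (eps : R) (k : R -> R[i]) :=
  forall t, t \in `[0%R, 1%R] -> `|k t - f t| < eps%:C.

Definition K_unif_limit {T : Type} {R : realType} (ST : int -> T -> R)
  (w : T) (k : R -> R[i]) :=
  forall eps : R, 0 < eps -> exists N0 : nat, forall N, (N0 <= N)%N ->
    forall t, t \in `[0%R, 1%R] -> `|K_partial ST N w t - k t| < eps%:C.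

(* f lies in the support of the law of K: every (sup-norm ball) neighbourhood
   of f has positive probability under the law of K = a.s. uniform limit of
   the symmetric partial sums. *)
Definition in_support_K {d : measure_display} {T : measurableType d}
  {R : realType} (P : probability T R) (ST : int -> T -> R) (f : R -> R[i]) :=
  forall eps : R, 0 < eps ->
    (0 < P [set w | exists k : R -> R[i], K_unif_limit ST w k /\ sup_ball f eps k])%E.

(* Main.v *)
Require Import Defs.
From HB Require Import structures.
From mathcomp Require Import all_boot all_order all_algebra.
From mathcomp Require Import all_classical all_reals all_analysis.
From mathcomp Require Import measurable_realfun complex.
From mathcomp Require Import ring lra zify.

(* For real coefficients [x h] consider the path
     [t * x 0 + \sum_(0 < |h| <= N) x h * (e(h t) - 1) / (2 pi i h)],
   whose bridge [f t - t * f 1] has Fourier coefficient [x h / (2 pi i h)] at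
   [0 < |h| <= N] and [0] at the other nonzero [h]. When [|x h| <= 2] it thus satisfies
   the conditions of the theorem, and these are preserved by uniform limits. Conversely,
   if [f] satisfies them then the Fejer means of its bridge, translated to vanish at [0],
   are bridges of such paths, so [f] is a uniform limit of them. Hence the support has to
   be identified with the uniform closure of these paths.

   Since [|ST h| <= 2] almost surely, the support lies in the closure. For the converse,
   fix a path with [|x h| <= 2] and ask that [ST h] be close to [x h] for [|h| < 16^m0], an
   event of positive probability. Given this event the remaining variables are still
   independent with exponential moments of Gaussian type, so that for each [m >= m0] the
   partial sums over the block [16^m <= |h| < 16^(m+1)] are [O(2^-m)] at the points of a
   grid of step [32^-m] outside an event of probability [O(2^-m)]. As the sums over a block
   are [O(16^m)]-Lipschitz, the grid controls them uniformly, and for [m0] large the tail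
   of the series is small with conditional probability at least [1/2]. *)

Set Implicit Arguments.
Unset Strict Implicit.
Unset Printing Implicit Defensive.

Import Order.TTheory GRing.Theory Num.Theory.
Import numFieldNormedType.Exports numFieldTopology.Exports.
Import Normc.

Local Open Scope classical_set_scope.
Local Open Scope ring_scope.
Local Open Scope complex_scope.

(** * Independent random variables *)

Section density_measure.
Local Open Scope ereal_scope.
Context d (T : measurableType d) (R : realType) (mu : {measure set T -> \bar R}).
Variables (f : T -> R) (mf : measurable_fun setT f) (f0 : forall x, (0 <= f x)%R).

Definition density_measure of measurable_fun setT f & (forall x, (0 <= f x)%R) :=
  fun A : set T => \int[mu]_(x in A) (f x)%:E.

Local Notation nu := (density_measure mf f0).

Let density_measure0 : nu set0 = 0.
Proof. exact: integral_set0. Qed.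

Let density_measure_ge0 A : 0 <= nu A.
Proof. by apply: integral_ge0 => x _; rewrite lee_fin. Qed.

Let density_measure_sigma_additive : semi_sigma_additive nu.
Proof. by apply: semi_sigma_additive_nng_induced => //; exact/measurable_EFinP. Qed.

HB.instance Definition _ := isMeasure.Build _ _ _ nu density_measure0
  density_measure_ge0 density_measure_sigma_additive.

Import HBNNSimple.

Let integral_density_measure_nnsfun (h : {nnsfun T >-> R}) :
  \int[nu]_x (h x)%:E = \int[mu]_x ((h x)%:E * (f x)%:E).
Proof.
under [LHS]eq_integral do rewrite fimfunE -fsumEFin//.
rewrite [LHS]ge0_integral_fsum//; last 2 first.
- by move=> r; exact/measurable_EFinP/measurableT_comp.
- by move=> n x _; rewrite EFinM nnfun_muleindic_ge0.
under [RHS]eq_integral => x _.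
  rewrite fimfunE -fsumEFin// ge0_mule_fsuml; last first.
    by move=> r; exact: nnfun_muleindic_ge0.
  over.
rewrite [RHS]ge0_integral_fsum//; last 2 first.
- move=> r; apply/emeasurable_funM; last exact/measurable_EFinP.
  exact/measurable_EFinP/measurableT_comp.
- by move=> r x _; apply: mule_ge0; [exact: nnfun_muleindic_ge0|rewrite lee_fin].
apply: eq_fsbigr => r rh.
have r0 : (0 <= r)%R by move: rh; rewrite inE => -[x _ <-].
rewrite integralZl_indic_nnsfun// integral_indic//= setIT /density_measure.
under [RHS]eq_integral do rewrite EFinM -muleA.
rewrite ge0_integralZl//; last 2 first.
- apply/emeasurable_funM; last exact/measurable_EFinP.
  exact/measurable_EFinP.
- by move=> x _; rewrite mule_ge0 ?lee_fin.
congr (_ * _); rewrite integral_mkcond; apply: eq_integral => x _.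
by rewrite patchE indicE; case: ifPn => _; rewrite ?mul1e ?mul0e.
Qed.

Lemma ge0_integral_density_measure (g : T -> R) :
  measurable_fun setT g -> (forall x, 0 <= g x)%R ->
  \int[nu]_x (g x)%:E = \int[mu]_x (g x * f x)%:E.
Proof.
move=> /measurable_EFinP mg g0; pose g_ := nnsfun_approx measurableT mg.
have cvg_g x : (g_ n x)%:E @[n --> \oo] --> (g x)%:E.
  by apply: cvg_nnsfun_approx => // y _; rewrite lee_fin.
have nd_g x : nondecreasing_seq (fun n => g_ n x).
  by move=> m n mn; exact/lefP/nd_nnsfun_approx.
transitivity (limn (fun n => \int[nu]_x (g_ n x)%:E)).
  rewrite -monotone_convergence//.
  - by apply: eq_integral => x _; apply/esym/cvg_lim => //; exact: cvg_g.
  - by move=> n; exact/measurable_EFinP.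
  - by move=> n x _; rewrite lee_fin.
  - by move=> x _ m n mn; rewrite lee_fin; exact: nd_g.
under eq_fun do rewrite integral_density_measure_nnsfun.
rewrite -monotone_convergence//.
- apply: eq_integral => x _; rewrite EFinM; apply/cvg_lim => //.
  by apply: cvgeZr => //; exact: cvg_g.
- by move=> n; apply: emeasurable_funM; exact/measurable_EFinP.
- by move=> n x _; rewrite mule_ge0 ?lee_fin.
- by move=> x _ m n mn; rewrite lee_wpmul2r ?lee_fin//; exact: nd_g.
Qed.

End density_measure.

Lemma ge0_integral_scaled_law d (T : measurableType d) d' (S : measurableType d')
    (R : realType) (mu nu : {measure set T -> \bar R}) (X : T -> S) (k : R) (phi : S -> R) :
  measurable_fun setT X -> 0 <= k ->
  (forall B, measurable B -> mu (X @^-1` B) = k%:E * nu (X @^-1` B))%E ->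
  measurable_fun setT phi -> (forall x, 0 <= phi x) ->
  (\int[mu]_w (phi (X w))%:E = k%:E * \int[nu]_w (phi (X w))%:E)%E.
Proof.
move=> mX k0 law mphi phi0.
have phi_ge0 : {in [set: S], forall x, (0 <= (phi x)%:E)%E} by move=> x _; rewrite lee_fin.
have mphiE : measurable_fun setT (EFin \o phi) by exact/measurable_EFinP.
have := ge0_integral_pushforward mX nu measurableT mphiE phi_ge0.
have := ge0_integral_pushforward mX mu measurableT mphiE phi_ge0.
rewrite preimage_setT => <- <-.
rewrite -(ge0_integral_mscale (pushforward nu X) measurableT (NngNum k0))//.
  by apply: eq_measure_integral => B mB _; exact: law.
by move=> x _; rewrite lee_fin.
Qed.

Section independence.
Context d (T : measurableType d) d' (S : measurableType d') (R : realType) (I : eqType).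
Variables (P : probability T R) (X : I -> T -> S).
Hypothesis mX : forall i, measurable_fun setT (X i).
Implicit Types (mu : {measure set T -> \bar R}) (J : seq I) (B : I -> set S).

Definition cylinder J B : set T := \big[setI/setT]_(j <- J) (X j @^-1` B j).

(* Up to normalization, the variables [X j] with [j] in [J] are independent under
   [mu] and have the same laws as under [P]. *)
Definition independent_under mu J := forall B, (forall j, measurable (B j)) ->
  (mu (cylinder J B) = mu setT * \prod_(j <- J) P (X j @^-1` B j))%E.

Lemma measurable_cylinder J B : (forall j, measurable (B j)) -> measurable (cylinder J B).
Proof.
move=> mB; apply: bigsetI_measurable => j _.
by rewrite -[_ @^-1` _]setTI; exact: mX.
Qed.

Lemma measurable_prod_comp J (phi : I -> S -> R) :
  (forall j, measurable_fun setT (phi j)) ->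
  measurable_fun setT (fun w => \prod_(j <- J) phi j (X j w)).
Proof.
move=> mphi; elim: J => [|j J IH].
  by under eq_fun do rewrite big_nil; exact: measurable_cst.
under eq_fun do rewrite big_cons.
by apply: measurable_funM => //; exact: measurableT_comp.
Qed.

Lemma integral_cylinder_comp mu j J B (phi : S -> R) :
  mu setT \is a fin_num -> j \notin J -> independent_under mu (j :: J) ->
  (forall i, measurable (B i)) -> measurable_fun setT phi -> (forall x, 0 <= phi x) ->
  (\int[mu]_(w in cylinder J B) (phi (X j w))%:E =
   mu setT * \prod_(i <- J) P (X i @^-1` B i) * \int[P]_w (phi (X j w))%:E)%E.
Proof.
move=> mu_fin jJ indep mB mphi phi0; have mJ := measurable_cylinder J mB.
have finX i : P (X i @^-1` B i) \is a fin_num.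
  by rewrite fin_num_measure// -[_ @^-1` _]setTI; exact: mX.
pose k := fine (mu setT) * \prod_(i <- J) fine (P (X i @^-1` B i)).
have kE : (mu setT * \prod_(i <- J) P (X i @^-1` B i))%E = k%:E.
  by rewrite EFinM fineK// -prodEFin; congr (_ * _)%E; apply: eq_bigr => i _; rewrite fineK.
have k0 : 0 <= k.
  by rewrite mulr_ge0 ?fine_ge0// prodr_ge0// => i _; exact: fine_ge0.
have m1 : measurable_fun setT (\1_(cylinder J B) : T -> R) by exact: measurable_indic.
have pos1 w : 0 <= (\1_(cylinder J B) w : R) by rewrite indicE.
transitivity (\int[density_measure mu m1 pos1]_w (phi (X j w))%:E)%E.
  rewrite ge0_integral_density_measure//; last exact: measurableT_comp.
  rewrite integral_mkcond; apply: eq_integral => w _.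
  by rewrite patchE indicE; case: ifP; rewrite ?mulr1 ?mulr0.
rewrite kE; apply: ge0_integral_scaled_law => // A mA.
have mXA : measurable (X j @^-1` A) by rewrite -[_ @^-1` _]setTI; exact: mX.
pose BA i := if i == j then A else B i.
have BA_off i : i \in J -> BA i = B i.
  by move=> iJ; rewrite /BA ifN//; apply: contraNneq jJ => <-.
have cylBA : cylinder (j :: J) BA = X j @^-1` A `&` cylinder J B.
  rewrite /cylinder big_cons /BA eqxx; congr (_ `&` _).
  by apply: eq_big_seq => i /BA_off BAi; rewrite -/(BA i) BAi.
have prodBA : (\prod_(i <- J) P (X i @^-1` BA i) = \prod_(i <- J) P (X i @^-1` B i))%E.
  by apply: eq_big_seq => i /BA_off ->.
rewrite [X in X = _]/= /density_measure integral_indic// setIC -cylBA indep; last first.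
  by move=> i; rewrite /BA; case: ifP.
by rewrite big_cons prodBA /BA eqxx -kE muleCA muleC.
Qed.

(* Expectations of products are computed by tilting [mu] by one factor at a time. *)
Lemma independent_under_tilt mu j J (phi : S -> R) (mphi : measurable_fun setT (phi \o X j))
    (phi0 : forall w, 0 <= (phi \o X j) w) :
  measurable_fun setT phi -> (forall x, 0 <= phi x) ->
  mu setT \is a fin_num -> j \notin J -> independent_under mu (j :: J) ->
  density_measure mu mphi phi0 setT = (mu setT * \int[P]_w (phi (X j w))%:E)%E /\
  independent_under (density_measure mu mphi phi0) J.
Proof.
move=> mphiS phiS0 mu_fin jJ indep.
have total : density_measure mu mphi phi0 setT = (mu setT * \int[P]_w (phi (X j w))%:E)%E.
  have := @integral_cylinder_comp mu j J (fun=> setT) phi mu_fin jJ indep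
    (fun=> measurableT) mphiS phiS0.
  rewrite /cylinder !big1//; last by move=> i _; rewrite preimage_setT probability_setT.
  by rewrite mule1.
split=> // B mB; rewrite [X in _ = (X * _)%E]total muleAC.
exact: integral_cylinder_comp.
Qed.

Lemma integral_prod_independent mu J (phi : I -> S -> R) (c : I -> R) :
  (forall j, measurable_fun setT (phi j)) -> (forall j x, 0 <= phi j x) ->
  (forall j, \int[P]_w (phi j (X j w))%:E = (c j)%:E)%E ->
  mu setT \is a fin_num -> uniq J -> independent_under mu J ->
  (\int[mu]_w (\prod_(j <- J) phi j (X j w))%:E = mu setT * (\prod_(j <- J) c j)%:E)%E.
Proof.
move=> mphi phi0 Ec; elim: J mu => [|j J IH] mu mu_fin uJ indep.
  under eq_integral do rewrite big_nil.
  by rewrite integral_cst// mul1e big_nil mule1.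
have /andP[jJ {}uJ] := uJ.
have mphij : measurable_fun setT (phi j \o X j) by exact: measurableT_comp.
have phij0 w : 0 <= (phi j \o X j) w by exact: phi0.
have [total tilted] := independent_under_tilt mphij phij0 (mphi j) (phi0 j) mu_fin jJ indep.
under eq_integral do rewrite big_cons mulrC.
rewrite -(ge0_integral_density_measure mu mphij phij0); last 2 first.
- exact: measurable_prod_comp.
- by move=> w; exact: prodr_ge0.
rewrite IH//; last by rewrite [X in X \is a _]total Ec fin_numM.
by rewrite [X in (X * _)%E]total Ec big_cons EFinM muleA.
Qed.

End independence.

Section chernoff.
Context d (T : measurableType d) (R : realType) (I : eqType).
Variables (P : probability T R) (X : I -> T -> R) (C : R).
Hypothesis mX : forall i, measurable_fun setT (X i).
Hypothesis laplaceX : forall i s,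
  (\int[P]_w (expR (s * X i w))%:E <= (expR (C * s ^+ 2))%:E)%E.
Implicit Types (mu : {measure set T -> \bar R}) (J : seq I) (a : I -> R) (s l : R).

Lemma laplace_sum_independent mu J a s :
  mu setT \is a fin_num -> uniq J -> independent_under P X mu J ->
  (\int[mu]_w (expR (s * \sum_(j <- J) a j * X j w))%:E <=
   mu setT * (expR (C * s ^+ 2 * \sum_(j <- J) a j ^+ 2))%:E)%E.
Proof.
move=> mu_fin uJ indep.
pose phi j x := expR (s * a j * x).
have mphi j : measurable_fun setT (phi j).
  by apply/measurableT_comp => //; exact: measurable_funM.
pose c j := fine (\int[P]_w (phi j (X j w))%:E).
have Ec j : (\int[P]_w (phi j (X j w))%:E = (c j)%:E)%E.
  rewrite /c fineK// ge0_fin_numE; last by apply: integral_ge0 => x _; rewrite lee_fin expR_ge0.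
  by apply: le_lt_trans (laplaceX j _) _; rewrite ltry.
have c_le j : c j <= expR (C * (s * a j) ^+ 2) by rewrite -lee_fin -Ec; exact: laplaceX.
have c0 j : 0 <= c j.
  by rewrite -lee_fin -Ec; apply: integral_ge0 => x _; rewrite lee_fin expR_ge0.
under eq_integral => w _.
  rewrite mulr_sumr expR_sum.
  under eq_bigr do rewrite mulrA -/(phi _ _).
  over.
rewrite (integral_prod_independent _ mphi _ Ec)//; last by move=> *; exact: expR_ge0.
apply: lee_wpmul2l; first exact: measure_ge0.
rewrite lee_fin mulr_sumr expR_sum.
by apply: ler_prod => j _; rewrite c0 -mulrA -exprMn c_le.
Qed.

(* Markov's inequality for [expR (s * _)]. *)
Lemma chernoff_independent mu J a s l :
  mu setT \is a fin_num -> uniq J -> independent_under P X mu J ->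
  0 <= s ->
  (mu [set w | (l <= \sum_(j <- J) a j * X j w)%R] <=
   mu setT * (expR (C * s ^+ 2 * (\sum_(j <- J) a j ^+ 2) - s * l))%:E)%E.
Proof.
move=> mu_fin uJ indep s0; set Y := fun w => \sum_(j <- J) a j * X j w.
have mY : measurable_fun setT Y.
  by apply: measurable_sum => j; exact: measurable_funM.
have mE : measurable [set w | l <= Y w].
  by rewrite -[X in measurable X]setTI; exact: (measurable_fun_le _ (measurable_cst l) mY).
have mexp : measurable_fun setT (fun w => expR (s * Y w)).
  by apply/measurableT_comp => //; exact: measurable_funM.
rewrite expRD expRN EFinM muleA lee_pdivlMr ?expR_gt0//.
apply: le_trans (laplace_sum_independent a s mu_fin uJ indep).
rewrite muleC -integral_cst//.
apply: (@le_trans _ _ (\int[mu]_(w in [set w | (l <= Y w)%R]) (expR (s * Y w))%:E)%E).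
  apply: ge0_le_integral => //.
  - by move=> w _; rewrite lee_fin expR_ge0.
  - exact/measurable_EFinP/measurable_funTS.
  - by move=> w /= lY; rewrite lee_fin ler_expR ler_wpM2l.
by apply: ge0_subset_integral => //; exact/measurable_EFinP.
Qed.

Lemma chernoff_norm_independent mu J a s l :
  mu setT \is a fin_num -> uniq J -> independent_under P X mu J -> 0 <= s ->
  (mu [set w | (l <= `|\sum_(j <- J) a j * X j w|)%R] <=
   mu setT * (2 * expR (C * s ^+ 2 * (\sum_(j <- J) a j ^+ 2) - s * l))%:E)%E.
Proof.
move=> mu_fin uJ indep s0.
have mle b : measurable [set w | l <= \sum_(j <- J) b j * X j w].
  rewrite -[X in measurable X]setTI; apply: measurable_fun_le => //.
  by apply: measurable_sum => j; exact: measurable_funM.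
have SN w : \sum_(j <- J) - a j * X j w = - \sum_(j <- J) a j * X j w.
  by rewrite -sumrN; apply: eq_bigr => j _; rewrite mulNr.
have -> : [set w | l <= `|\sum_(j <- J) a j * X j w|] =
    [set w | l <= \sum_(j <- J) a j * X j w] `|` [set w | l <= \sum_(j <- J) - a j * X j w].
  by apply/seteqP; split=> w /=; rewrite SN ler_normr => /orP.
apply: le_trans (measureU2 mu (mle _) (mle _)) _.
rewrite mulr_natl mulr2n EFinD muleDr// ?ge0_adde_def ?inE ?lee_fin ?expR_ge0//.
apply: leeD; first exact: chernoff_independent.
rewrite (eq_bigr (fun j => (- a j) ^+ 2)) => [|j _]; last by rewrite sqrrN.
exact: chernoff_independent.
Qed.

End chernoff.

(** * Sato-Tate variables *)

Section centred_bounded.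
Context (R : realType).
Implicit Types (x y s M : R).

Lemma expR_le_quadratic y : y <= 2^-1 -> expR y <= 1 + y + 2 * y ^+ 2.
Proof.
move=> y2; have := expR_ge1Dx (- y); rewrite expRN => invE.
have [E0 y1] : 0 < expR y /\ 0 < 1 - y by rewrite expR_gt0; split; lra.
have : expR y <= (1 - y)^-1 by rewrite -[expR y]invrK lef_pV2// posrE invr_gt0.
move/le_trans; apply; rewrite -[leLHS]mul1r ler_pdivrMr//.
nra.
Qed.

Lemma cosh_le_expR_sqr y : (expR y + expR (- y)) / 2 <= expR (2 * y ^+ 2).
Proof.
wlog y0 : y / 0 <= y => [hw|].
  have [/hw//|/ltW y0] := leP 0 y.
  by have := hw (- y); rewrite oppr_ge0 opprK sqrrN addrC; exact.
have [y2|y2] := leP y 2^-1.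
  apply: le_trans (expR_ge1Dx _).
  have yN2 : - y <= 2^-1 by lra.
  by have := expR_le_quadratic y2; have := expR_le_quadratic yN2; rewrite sqrrN; lra.
have : expR y <= expR (2 * y ^+ 2) by rewrite ler_expR; nra.
have : expR (- y) <= expR y by rewrite ler_expR; lra.
lra.
Qed.

Lemma expR_le_chord x M : 0 < M -> `|x| <= M -> forall s,
  expR (s * x) <= (expR (s * M) + expR (- (s * M))) / 2 +
                  (expR (s * M) - expR (- (s * M))) / (2 * M) * x.
Proof.
move=> M0; rewrite ler_norml => /andP[Mx xM] s.
have MM0 : 0 < 2 * M by lra.
have p0 : 0 <= (x + M) / (2 * M) by rewrite divr_ge0//; lra.
have p1 : (x + M) / (2 * M) <= 1 by rewrite ler_pdivrMr//; lra.
have := convex_expR (Itv01 p0 p1) (s * M) (- (s * M)).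
rewrite !convRE /unstable.onem/= => /le_trans.
have -> : (x + M) / (2 * M) * (s * M) + (1 - (x + M) / (2 * M)) * - (s * M) = s * x.
  by field; lra.
apply; move: (expR _) (expR _) => u v; rewrite le_eqVlt; apply/orP; left; apply/eqP.
by field; lra.
Qed.

Context d (T : measurableType d) (P : probability T R) (X : T -> R).
Hypothesis mX : measurable_fun setT X.

Lemma ae_bounded_integrable M : 0 <= M -> {ae P, forall w, `|X w| <= M} ->
  P.-integrable setT (EFin \o X).
Proof.
move=> M0 XM; have mXE : measurable_fun setT (EFin \o X) by exact/measurable_EFinP.
apply/integrableP; split=> //; apply: le_lt_trans (ltry M).
rewrite -[leRHS]mule1 -(probability_setT P).
by apply: integral_le_bound => //; apply: filterS XM => w Xw _; rewrite lee_fin.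
Qed.

(* Hoeffding's lemma, up to the constant. *)
Lemma centred_bounded_laplace M s : 0 < M -> {ae P, forall w, `|X w| <= M} ->
  (\int[P]_w (X w)%:E = 0)%E ->
  (\int[P]_w (expR (s * X w))%:E <= (expR (2 * M ^+ 2 * s ^+ 2))%:E)%E.
Proof.
move=> M0 XM EX0.
pose a := (expR (s * M) + expR (- (s * M))) / 2.
pose b := (expR (s * M) - expR (- (s * M))) / (2 * M).
pose chord x := a + b * x.
have intX : P.-integrable setT (EFin \o X) by exact: ae_bounded_integrable (ltW M0) XM.
have mchord : measurable_fun setT (chord \o X).
  by apply: measurable_funD => //; apply: measurable_funM.
apply: (@le_trans _ _ (\int[P]_w `|chord (X w)|%:E)%E).
  apply: ae_ge0_le_integral => //.
  - by apply/measurable_EFinP; apply/measurableT_comp => //; exact: measurable_funM.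
  - exact/measurable_EFinP/measurableT_comp.
  - apply: filterS XM => w Xw _; rewrite lee_fin.
    exact: le_trans (expR_le_chord M0 Xw s) (ler_norm _).
rewrite (_ : (\int[P]_w `|chord (X w)|%:E = \int[P]_w (chord (X w))%:E)%E); last first.
  apply: ae_eq_integral => //.
  - exact/measurable_EFinP/measurableT_comp.
  - exact/measurable_EFinP.
  - apply: filterS XM => w Xw _; rewrite ger0_norm//.
    by apply: le_trans (expR_le_chord M0 Xw s); exact: expR_ge0.
under eq_integral do rewrite EFinD (EFinM b).
rewrite integralD//; [|exact: finite_measure_integrable_cst|exact: integrableZl].
rewrite integral_cst//= probability_setT mule1 integralZl// EX0 mule0 adde0 lee_fin.
have -> : 2 * M ^+ 2 * s ^+ 2 = 2 * (s * M) ^+ 2 by ring.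
exact: cosh_le_expR_sqr.
Qed.

Lemma symmetric_integral0 : P.-integrable setT (EFin \o X) ->
  (forall A, measurable A -> P (X @^-1` A) = P ((fun w => - X w) @^-1` A)) ->
  (\int[P]_w (X w)%:E = 0)%E.
Proof.
move=> intX symX; pose NX w := - X w.
have mNX : measurable_fun setT NX by exact: measurableT_comp.
have intNX : P.-integrable setT (EFin \o NX).
  by have := integrableN intX; apply: eq_integrable.
have EN : (\int[P]_w (X w)%:E = \int[P]_w (NX w)%:E)%E.
  transitivity (\int[pushforward P X]_x (x%:E))%E.
    by rewrite integral_pushforward//; exact/measurable_EFinP.
  transitivity (\int[pushforward P NX]_x (x%:E))%E.
    by apply: eq_measure_integral => A mA _; exact: symX.
  by rewrite integral_pushforward//; exact/measurable_EFinP.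
move: EN; under [in RHS]eq_integral do rewrite EFinN.
rewrite integralN//; last exact: integrable_add_def.
have := integrable_fin_num measurableT intX.
by case: (\int[P]_w _)%E => // r _ [] rE; congr _%:E; lra.
Qed.

End centred_bounded.

Section sato_tate.
Context (R : realType).

Definition sato_tate_density (x : R) : R := Num.sqrt (1 - x ^+ 2 / 4) / pi.
Local Notation rho := sato_tate_density.

Lemma measurable_sato_tate_density : measurable_fun setT rho.
Proof.
apply: continuous_measurable_fun => x; apply: cvgM; last exact: cvg_cst.
apply: (@continuous_comp R R R (fun x : R => 1 - x ^+ 2 / 4) Num.sqrt).
  apply: cvgB; first exact: cvg_cst.
  by apply: cvgM; [exact: exprn_continuous|exact: cvg_cst].
exact: sqrt_continuous.
Qed.

Lemma sato_tate_density_ge0 x : 0 <= rho x.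
Proof. by rewrite mulr_ge0// ?sqrtr_ge0// invr_ge0 pi_ge0. Qed.

Lemma sato_tate_density_gt0 x : -2 < x < 2 -> 0 < rho x.
Proof. by move=> /andP[x1 x2]; rewrite divr_gt0 ?pi_gt0// sqrtr_gt0; nra. Qed.

Lemma sato_tate_densityN x : rho (- x) = rho x.
Proof. by rewrite /sato_tate_density sqrrN. Qed.

Lemma sato_tate_density_ge_min a b x : a <= x <= b -> Num.min (rho a) (rho b) <= rho x.
Proof.
move=> /andP[ax xb]; rewrite ge_min; apply/orP.
by have [x0|x0] := leP 0 x; [right|left];
  rewrite ler_pM2r ?invr_gt0 ?pi_gt0// ler_wsqrtr//; nra.
Qed.

Context d (T : measurableType d) (P : probability T R) (X : T -> R).
Hypothesis mX : measurable_fun setT X.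
Hypothesis lawX : sato_tate_law P X.

Lemma sato_tate_ae_bounded : {ae P, forall w, `|X w| <= 2}.
Proof.
have mB : measurable [set w | `|X w| <= 2].
  rewrite -[X in measurable X]setTI.
  by apply: measurable_fun_le => //; exact: measurableT_comp.
exists (~` [set w | `|X w| <= 2]); split=> //; first exact: measurableC.
rewrite probability_setC// (_ : [set w | _] = X @^-1` `[(-2)%R, 2%R]); last first.
  by apply/seteqP; split => w /=; rewrite in_itv/= ler_norml.
have := lawX measurableT; rewrite setTI preimage_setT probability_setT => total.
by rewrite lawX// setIid -total subee.
Qed.

Lemma sato_tate_law_symmetric A : measurable A ->
  P (X @^-1` A) = P ((fun w => - X w) @^-1` A).
Proof.
move=> mA; have mNA : measurable ((-%R : R -> R) @^-1` A).
  by rewrite -[_ @^-1` _]setTI; exact: oppr_measurable.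
rewrite -[(fun w => - X w) @^-1` A]/(X @^-1` ((-%R : R -> R) @^-1` A)) !lawX//.
have -> : (-%R : R -> R) @^-1` A `&` `[(-2)%R, 2%R] =
    (-%R : R -> R) @^-1` (A `&` `[(-2)%R, 2%R]).
  rewrite preimage_setI; congr (_ `&` _).
  by rewrite opp_preimage_itvbndbnd opprK.
have mD : measurable (A `&` `[(-2)%R, 2%R]) by exact: measurableI.
have mrho : measurable_fun (A `&` `[(-2)%R, 2%R]) (EFin \o rho).
  apply/measurable_EFinP/measurable_funTS; exact: measurable_sato_tate_density.
transitivity (\int[pushforward lebesgue_measure (-%R : _ -> measurableTypeR R)]_(x in
    A `&` `[(-2)%R, 2%R]) (rho x)%:E)%E.
  by apply: eq_measure_integral => B mB _; exact/esym/lebesgue_measureN.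
rewrite ge0_integral_pushforward//; last by move=> y _; rewrite lee_fin sato_tate_density_ge0.
by apply: eq_integral => x _ /=; rewrite sato_tate_densityN.
Qed.

Lemma sato_tate_mean0 : (\int[P]_w (X w)%:E = 0)%E.
Proof.
apply: symmetric_integral0 => //; last exact: sato_tate_law_symmetric.
by apply: (@ae_bounded_integrable _ _ _ _ _ _ 2) => //; exact: sato_tate_ae_bounded.
Qed.

Lemma sato_tate_laplace s :
  (\int[P]_w (expR (s * X w))%:E <= (expR (8 * s ^+ 2))%:E)%E.
Proof.
have -> : 8 = 2 * 2 ^+ 2 :> R by ring.
apply: centred_bounded_laplace => //; first exact: sato_tate_ae_bounded.
exact: sato_tate_mean0.
Qed.

Lemma sato_tate_segment_gt0 a b : -2 < a -> a < b -> b < 2 -> (0 < P (X @^-1` `[a, b]))%E.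
Proof.
move=> a2 ab b2; pose c := Num.min (rho a) (rho b).
have c0 : 0 < c by rewrite lt_min !sato_tate_density_gt0//; apply/andP; split; lra.
rewrite lawX// (_ : `[a, b]%classic `&` _ = `[a, b]%classic); last first.
  by apply/setIidPl => x /=; rewrite !in_itv/= => /andP[? ?]; apply/andP; split; lra.
apply: (@lt_le_trans _ _ (\int[lebesgue_measure]_(x in `[a, b]) c%:E)%E).
  rewrite integral_cst//= lebesgue_measure_itv/= lte_fin ab -EFinB -EFinM lte_fin.
  by rewrite mulr_gt0// subr_gt0.
apply: ge0_le_integral => //.
- by move=> x _; rewrite lee_fin ltW.
- apply/measurable_EFinP/measurable_funTS; exact: measurable_sato_tate_density.
- by move=> x /=; rewrite in_itv/= => xab; rewrite lee_fin sato_tate_density_ge_min.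
Qed.

Lemma sato_tate_ball_gt0 (y e : R) : -2 <= y <= 2 -> 0 < e ->
  (0 < P (X @^-1` `](y - e)%R, (y + e)%R[))%E.
Proof.
move=> /andP[y1 y2] e0.
pose a := Num.max (-2) (y - e); pose b := Num.min 2 (y + e).
have ab : a < b.
  by rewrite /a /b lt_min !gt_max; apply/andP; split; apply/andP; split; lra.
have [a1 a2] : -2 <= a /\ y - e <= a by rewrite /a !le_max !lexx orbT.
have [b1 b2] : b <= 2 /\ b <= y + e by rewrite /b !ge_min !lexx orbT.
apply: (@lt_le_trans _ _ (P (X @^-1` `[(a + (b - a) / 3)%R, (b - (b - a) / 3)%R]))).
  by apply: sato_tate_segment_gt0; lra.
apply: le_measure; rewrite ?inE.
- by rewrite -[_ @^-1` _]setTI; exact: mX.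
- by rewrite -[_ @^-1` _]setTI; exact: mX.
by move=> w /=; rewrite !in_itv/= => /andP[? ?]; apply/andP; split; lra.
Qed.

End sato_tate.

(** * Complex-valued continuous functions on the unit interval *)

Section complex_modulus.
Context (R : realType).
Implicit Types (x : R) (z : R[i]).

Lemma normr_normc z : `|z| = (normc z)%:C.
Proof. by []. Qed.

Lemma normc_ge0 z : 0 <= normc z.
Proof. by case: z => a b; exact: sqrtr_ge0. Qed.

Lemma normcR x : normc x%:C = `|x|.
Proof. by rewrite /= expr0n addr0 sqrtr_sqr. Qed.

Lemma sqr_normcE z : normc z ^+ 2 = complex.Re z ^+ 2 + complex.Im z ^+ 2.
Proof. by case: z => a b; rewrite sqr_sqrtr// addr_ge0 ?sqr_ge0. Qed.

Lemma normcC z1 z2 : normc (z1 - z2) = normc (z2 - z1).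
Proof. by rewrite -normcN opprB. Qed.

Lemma ler_distcD z3 z1 z2 : normc (z1 - z2) <= normc (z1 - z3) + normc (z3 - z2).
Proof. by rewrite -[z1 - z2](subrKA z3); exact: le_normcD. Qed.

Lemma ler_dist_normc z1 z2 : `|normc z1 - normc z2| <= normc (z1 - z2).
Proof.
have := le_normcD (z1 - z2) z2; have := le_normcD (z2 - z1) z1.
by rewrite !subrK normcC ler_norml => *; apply/andP; split; lra.
Qed.

Lemma ler_normc_sum (I : Type) (r : seq I) (p : pred I) (F : I -> R[i]) :
  normc (\sum_(i <- r | p i) F i) <= \sum_(i <- r | p i) normc (F i).
Proof.
elim/big_rec2: _ => [|i u z _ le_zu]; first by rewrite normc0.
by apply: le_trans (le_normcD _ _) _; rewrite lerD2l.
Qed.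

Lemma Re_le_normc z : `|complex.Re z| <= normc z.
Proof. by case: z => a b; rewrite -sqrtr_sqr ler_wsqrtr// lerDl sqr_ge0. Qed.

Lemma Im_le_normc z : `|complex.Im z| <= normc z.
Proof. by case: z => a b; rewrite -sqrtr_sqr ler_wsqrtr// lerDr sqr_ge0. Qed.

Lemma normc_le_ReIm z : normc z <= `|complex.Re z| + `|complex.Im z|.
Proof.
rewrite {1}(complexE z) mulrC; apply: le_trans (le_normcD _ _) _.
by rewrite normcR normcM normcR /= expr0n expr1n add0r sqrtr1 mulr1.
Qed.

Lemma ReD z1 z2 : complex.Re (z1 + z2) = complex.Re z1 + complex.Re z2.
Proof. by case: z1 z2 => [? ?] [? ?]. Qed.

Lemma ImD z1 z2 : complex.Im (z1 + z2) = complex.Im z1 + complex.Im z2.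
Proof. by case: z1 z2 => [? ?] [? ?]. Qed.

Lemma ReM z1 z2 : complex.Re (z1 * z2) =
  complex.Re z1 * complex.Re z2 - complex.Im z1 * complex.Im z2.
Proof. by case: z1 z2 => [? ?] [? ?]. Qed.

Lemma ImM z1 z2 : complex.Im (z1 * z2) =
  complex.Re z1 * complex.Im z2 + complex.Im z1 * complex.Re z2.
Proof. by case: z1 z2 => [? ?] [? ?]. Qed.

Lemma ReB z1 z2 : complex.Re (z1 - z2) = complex.Re z1 - complex.Re z2.
Proof. by case: z1 z2 => [? ?] [? ?]. Qed.

Lemma ImB z1 z2 : complex.Im (z1 - z2) = complex.Im z1 - complex.Im z2.
Proof. by case: z1 z2 => [? ?] [? ?]. Qed.

Lemma normc_conjc z : normc z^* = normc z.
Proof. by case: z => a b; rewrite /= sqrrN. Qed.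

Lemma mulcJ z : z * z^* = (normc z ^+ 2)%:C.
Proof. by rewrite -sqr_normc normr_normc rmorphXn. Qed.

End complex_modulus.

Definition continuous01 (R : realType) (V : topologicalType) (f : R -> V) : Prop :=
  {within `[0%R, 1%R], continuous f}.

Local Notation Ccontinuous01 g := (@continuous01 _ (_[i])^o g).

Section continuous01.
Context (R : realType).
Implicit Types (f g : R -> R[i]) (u v : R -> R) (t y e : R).

Lemma continuous01P (K : numFieldType) (V : normedModType K) (f : R -> V) :
  continuous01 f <-> forall t, 0 <= t <= 1 -> forall e : K, 0 < e ->
  exists2 r, 0 < r & forall y, 0 <= y <= 1 -> `|t - y| < r -> `|f t - f y| < e.
Proof.
split=> [/subspace_continuousP cf t t01 e e0|cf].
  have /cf/cvgrPdist_lt/(_ _ e0) : (`[0%R, 1%R]%classic : set R) t by rewrite /= in_itv.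
  rewrite near_withinE => /nbhs_ballP[r /= r0 fr].
  by exists r => // y y01 ty; apply: fr; rewrite /= ?in_itv.
apply/subspace_continuousP => t /=; rewrite in_itv/= => t01.
apply/cvgrPdist_lt => e e0; have [r r0 fr] := cf _ t01 _ e0.
rewrite near_withinE; apply/nbhs_ballP; exists r => //= y ty.
by rewrite in_itv/= => y01; exact: fr.
Qed.

Lemma Ccontinuous01P f : Ccontinuous01 f <-> forall t, 0 <= t <= 1 -> forall e, 0 < e ->
  exists2 r, 0 < r & forall y, 0 <= y <= 1 -> `|t - y| < r -> normc (f t - f y) < e.
Proof.
rewrite continuous01P; split=> cf t t01 e e0.
  have [|r r0 fr] := cf _ t01 e%:C; first by rewrite ltcR.
  by exists r => // y y01 ty; rewrite -ltcR; exact: fr.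
have [Ime0 Ree0] : complex.Im e = 0 /\ 0 < complex.Re e.
  by move: e0; rewrite ltcE => /andP[/eqP].
have [r r0 fr] := cf _ t01 _ Ree0; exists r => // y y01 ty.
by rewrite (complexE e) Ime0 mulr0 addr0 normr_normc ltcR; exact: fr.
Qed.

Lemma continuous01_Re f : Ccontinuous01 f -> continuous01 (fun t => complex.Re (f t)).
Proof.
move=> /Ccontinuous01P cf; apply/continuous01P => t t01 e e0.
have [r r0 fr] := cf _ t01 _ e0; exists r => // y y01 ty.
by rewrite -ReB; apply: le_lt_trans (Re_le_normc _) _; exact: fr.
Qed.

Lemma continuous01_Im f : Ccontinuous01 f -> continuous01 (fun t => complex.Im (f t)).
Proof.
move=> /Ccontinuous01P cf; apply/continuous01P => t t01 e e0.
have [r r0 fr] := cf _ t01 _ e0; exists r => // y y01 ty.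
by rewrite -ImB; apply: le_lt_trans (Im_le_normc _) _; exact: fr.
Qed.

Lemma continuous01_normc f : Ccontinuous01 f -> continuous01 (fun t => normc (f t)).
Proof.
move=> /Ccontinuous01P cf; apply/continuous01P => t t01 e e0.
have [r r0 fr] := cf _ t01 _ e0; exists r => // y y01 ty.
by apply: le_lt_trans (ler_dist_normc _ _) _; exact: fr.
Qed.

Lemma continuous01_complex u v : continuous01 u -> continuous01 v ->
  Ccontinuous01 (fun t => u t +i* v t).
Proof.
move=> /continuous01P cu /continuous01P cv; apply/Ccontinuous01P => t t01 e e0.
have e20 : 0 < e / 2 by rewrite divr_gt0.
have [r r0 ur] := cu _ t01 _ e20; have [s s0 vs] := cv _ t01 _ e20.
exists (Num.min r s) => [|y y01]; first by rewrite lt_min r0.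
rewrite lt_min => /andP[/(ur _ y01) uty /(vs _ y01) vty].
by apply: le_lt_trans (normc_le_ReIm _) _ => /=; lra.
Qed.

Lemma continuous01_cst (V : topologicalType) (c : V) : continuous01 (fun _ : R => c).
Proof. by apply: continuous_subspaceT => x; exact: cvg_cst. Qed.

Lemma continuous01D f g : Ccontinuous01 f -> Ccontinuous01 g ->
  Ccontinuous01 (fun t => f t + g t).
Proof. by move=> cf cg x; apply: cvgD; [exact: cf|exact: cg]. Qed.

Lemma continuous01B f g : Ccontinuous01 f -> Ccontinuous01 g ->
  Ccontinuous01 (fun t => f t - g t).
Proof. by move=> cf cg x; apply: cvgB; [exact: cf|exact: cg]. Qed.

Lemma continuous01M f g : Ccontinuous01 f -> Ccontinuous01 g ->
  Ccontinuous01 (fun t => f t * g t).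
Proof. by move=> cf cg x; apply: cvgM; [exact: cf|exact: cg]. Qed.

Lemma continuous01Z (c : R[i]) f : Ccontinuous01 f -> Ccontinuous01 (fun t => c * f t).
Proof. exact/continuous01M/continuous01_cst. Qed.

Lemma continuous01_sum (I : Type) (r : seq I) (F : I -> R -> R[i]) :
  (forall i, Ccontinuous01 (F i)) -> Ccontinuous01 (fun t => \sum_(i <- r) F i t).
Proof.
move=> cF; elim: r => [|i r IH].
  rewrite (_ : (fun t => _) = (fun=> 0)); first exact: continuous01_cst.
  by apply/funext => t; rewrite big_nil.
rewrite (_ : (fun t => _) = (fun t => F i t + \sum_(j <- r) F j t)).
  exact: (continuous01D (cF i) IH).
by apply/funext => t; rewrite big_cons.
Qed.

Lemma continuous01_approx f :
  (forall e, 0 < e -> exists2 g, Ccontinuous01 g &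
    forall t, 0 <= t <= 1 -> normc (f t - g t) < e) -> Ccontinuous01 f.
Proof.
move=> approx; apply/Ccontinuous01P => t t01 e e0.
have e30 : 0 < e / 3 by rewrite divr_gt0.
have [g /Ccontinuous01P cg fg] := approx _ e30.
have [r r0 gr] := cg _ t01 _ e30.
exists r => // y y01 /(gr _ y01) gty.
have := ler_distcD (g t) (f t) (f y); have := ler_distcD (g y) (g t) (f y).
by have := fg _ t01; have := fg _ y01; rewrite (normcC (g y)); lra.
Qed.

Lemma continuous01_bounded f : Ccontinuous01 f ->
  exists2 M, 0 < M & forall t, 0 <= t <= 1 -> normc (f t) <= M.
Proof.
move=> /continuous01_normc cf; have [a _ maxa] := EVT_max ler01 cf.
exists (normc (f a) + 1) => [|t t01]; first by rewrite ltr_wpDl// normc_ge0.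
by apply: ler_wpDr => //; apply: maxa; rewrite in_itv.
Qed.

Lemma continuous01_uniform f : Ccontinuous01 f -> forall e, 0 < e ->
  exists2 r, 0 < r & forall t y, 0 <= t <= 1 -> 0 <= y <= 1 ->
    `|t - y| < r -> normc (f t - f y) < e.
Proof.
move=> /Ccontinuous01P cf e e0.
have e20 : 0 < e / 2 by rewrite divr_gt0.
pose good (r t : R) := forall y, 0 <= y <= 1 -> `|t - y| < r -> normc (f t - f y) < e.
have cov := (near_covering_withinP _).2 ((compact_near_coveringP _).1 (@segment_compact R 0 1)).
have good_near : \forall r \near 0^'+, `[0%R, 1%R]%classic `<=` good r.
  apply: cov => x; rewrite /= in_itv/= => x01.
  have [r r0 fr] := cf _ x01 _ e20.
  have r20 : 0 < r / 2 by rewrite divr_gt0.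
  exists (ball x (r / 2), [set s | s < r / 2]).
    by split; [exact: nbhsx_ballx|exact: nbhs_right_lt].
  move=> [x' s] /= [xx' sr]; rewrite in_itv/= => x'01 y y01 x'y.
  rewrite /ball/= in xx'.
  have fxx' : normc (f x - f x') < e / 2 by apply: fr => //; lra.
  have fxy : normc (f x - f y) < e / 2.
    by apply: fr => //; apply: le_lt_trans (ler_distD x' _ _) _; lra.
  by apply: le_lt_trans (ler_distcD (f x) _ _) _; rewrite (normcC (f x')); lra.
have : \forall r \near 0^'+, 0 < r /\ `[0%R, 1%R]%classic `<=` good r.
  by near=> r; split; near: r; [exact: nbhs_right_gt|exact: good_near].
move=> /filter_ex[r [r0 good_r]]; exists r => // t y t01.
by apply: good_r; rewrite /= in_itv.
Unshelve. all: by end_near. Qed.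

End continuous01.

Notation "\int01_ t f" := (Rintegral lebesgue_measure `[0%R, 1%R] (fun t => f))
  (at level 36, f at level 36, t name, format "\int01_ t  f") : ring_scope.

Section integral01.
Context (R : realType).
Implicit Types (f g : R -> R[i]) (u v : R -> R) (t : R).

Lemma continuous01_integrable u : continuous01 u ->
  (@lebesgue_measure R).-integrable `[0%R, 1%R] (EFin \o u).
Proof.
by move=> cu; apply: continuous_compact_integrable => //; exact: segment_compact.
Qed.

Lemma Rintegral01_cst (c : R) : \int01_ t c = c.
Proof.
by rewrite Rintegral_cst//= lebesgue_measure_itv/= lte_fin ltr01 sube0 mulr1.
Qed.

Lemma Rintegral01_derive u (F : R -> R) : continuous01 u ->
  (forall t, is_derive t 1 F (u t)) -> \int01_ t u t = F 1 - F 0.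
Proof.
move=> cu dF.
have cF : continuous F by move=> t; apply: differentiable_continuous; apply/derivable1_diffP.
rewrite /Rintegral (@continuous_FTC2 R u F 0 1)//.
  split => [t _| |].
  - exact: ex_derive.
  - exact/cvg_at_right_filter/cF.
  - exact/cvg_at_left_filter/cF.
by move=> t _; rewrite derive1E; exact: derive_val.
Qed.

Lemma Rintegral01_scale (w : R) (F F' : R -> R) : continuous F' ->
  (forall x : R, is_derive x 1 F (F' x)) -> w * \int01_ t F' (w * t) = F w - F 0.
Proof.
move=> cF' dF.
have dw t : is_derive t 1 ( *%R w) w.
  by have := is_deriveZ w (is_derive_id t 1); rewrite scaler1.
have cF'w : continuous01 (fun t => F' (w * t)).
  apply: continuous_subspaceT => x; apply: continuous_comp; last exact: cF'.
  by apply: cvgM; [exact: cvg_cst|exact: cvg_id].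
rewrite -RintegralZl//; last exact: continuous01_integrable.
have := @Rintegral01_derive (fun t => w * F' (w * t)) (F \o *%R w).
rewrite /= mulr1 mulr0; apply => [x|t].
  by apply: cvgM; [exact: cvg_cst|exact: cF'w].
by apply: is_derive_eq (is_derive1_comp (dF (w * t)) (dw t)) _; rewrite mulrC.
Qed.

Definition Cintegral01 f : R[i] :=
  (\int01_ t complex.Re (f t)) +i* (\int01_ t complex.Im (f t)).

Let integrable_Re f : Ccontinuous01 f ->
  (@lebesgue_measure R).-integrable `[0%R, 1%R] (EFin \o (fun t => complex.Re (f t))).
Proof. by move=> /continuous01_Re/continuous01_integrable. Qed.

Let integrable_Im f : Ccontinuous01 f ->
  (@lebesgue_measure R).-integrable `[0%R, 1%R] (EFin \o (fun t => complex.Im (f t))).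
Proof. by move=> /continuous01_Im/continuous01_integrable. Qed.

Let integrable_Z (k : R) u : (@lebesgue_measure R).-integrable `[0%R, 1%R] (EFin \o u) ->
  (@lebesgue_measure R).-integrable `[0%R, 1%R] (EFin \o (fun t => k * u t)).
Proof. by move=> iu; exact: (integrableZl _ k iu). Qed.

Lemma eq_Cintegral01 f g : f =1 g -> Cintegral01 f = Cintegral01 g.
Proof. by move=> /funext ->. Qed.

Lemma Cintegral01_cst (c : R[i]) : Cintegral01 (fun=> c) = c.
Proof. by rewrite /Cintegral01 !Rintegral01_cst; case: c. Qed.

Lemma Cintegral01_real u : Cintegral01 (fun t => (u t)%:C) = (\int01_ t u t)%:C.
Proof. by rewrite /Cintegral01 /= Rintegral01_cst. Qed.

Lemma Cintegral01D f g : Ccontinuous01 f -> Ccontinuous01 g ->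
  Cintegral01 (fun t => f t + g t) = Cintegral01 f + Cintegral01 g.
Proof.
move=> cf cg; rewrite /Cintegral01.
under eq_Rintegral do rewrite ReD; under [X in _ +i* X]eq_Rintegral do rewrite ImD.
have [iRf iIf] := (integrable_Re cf, integrable_Im cf).
have [iRg iIg] := (integrable_Re cg, integrable_Im cg).
by rewrite (RintegralD _ iRf iRg) // (RintegralD _ iIf iIg).
Qed.

Lemma Cintegral01Z (c : R[i]) f : Ccontinuous01 f ->
  Cintegral01 (fun t => c * f t) = c * Cintegral01 f.
Proof.
move=> cf; have [iRe iIm] := (integrable_Re cf, integrable_Im cf).
rewrite /Cintegral01.
under eq_Rintegral do rewrite ReM; under [X in _ +i* X]eq_Rintegral do rewrite ImM.
rewrite RintegralB ?RintegralD ?RintegralZl //; try exact: integrable_Z.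
by apply/eqP; rewrite eq_complex /= ReM ImM /= !eqxx.
Qed.

Lemma Cintegral01B f g : Ccontinuous01 f -> Ccontinuous01 g ->
  Cintegral01 (fun t => f t - g t) = Cintegral01 f - Cintegral01 g.
Proof.
move=> cf cg; rewrite -[in RHS]mulN1r -(Cintegral01Z _ cg).
rewrite -(Cintegral01D cf (@continuous01Z _ (-1) _ cg)).
by apply: eq_Cintegral01 => t; rewrite mulN1r.
Qed.

Lemma Cintegral01_sum (I : Type) (r : seq I) (F : I -> R -> R[i]) :
  (forall i, Ccontinuous01 (F i)) ->
  Cintegral01 (fun t => \sum_(i <- r) F i t) = \sum_(i <- r) Cintegral01 (F i).
Proof.
move=> cF; elim: r => [|i r IH].
  rewrite big_nil -[RHS]Cintegral01_cst.
  by apply: eq_Cintegral01 => t; rewrite big_nil.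
rewrite big_cons -IH -(Cintegral01D (cF i) (@continuous01_sum _ _ r _ cF)).
by apply: eq_Cintegral01 => t; rewrite big_cons.
Qed.

(* Rotate the integral [I] onto the positive reals by the factor [I^*]. *)
Lemma normc_Cintegral01_le f u : Ccontinuous01 f -> continuous01 u ->
  (forall t, 0 <= t <= 1 -> normc (f t) <= u t) ->
  normc (Cintegral01 f) <= \int01_ t u t.
Proof.
move=> cf cu fu; set I := Cintegral01 f.
have iu := continuous01_integrable cu.
have [->|I0] := eqVneq I 0.
  rewrite normc0; apply: Rintegral_ge0 => // t; rewrite /= in_itv/= => t01.
  exact: le_trans (normc_ge0 _) (fu t t01).
have {}I0 : 0 < normc I by rewrite lt0r normc_ge0 andbT; apply: contra I0 => /eqP/eq0_normc ->.
rewrite -(ler_pM2l I0) -RintegralZl// -expr2.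
have -> : normc I ^+ 2 = \int01_ t complex.Re (I^* * f t).
  rewrite -[LHS]/(complex.Re (normc I ^+ 2)%:C) -mulcJ mulrC.
  by rewrite -[X in _ * X]/(Cintegral01 f) -Cintegral01Z.
apply: le_Rintegral => //.
- by apply: integrable_Re; exact: continuous01Z.
- exact: integrable_Z.
move=> t; rewrite /= in_itv/= => t01.
apply: le_trans (ler_norm _) _; apply: le_trans (Re_le_normc _) _.
by rewrite normcM normc_conjc ler_pM2l// fu.
Qed.

End integral01.

(** * Fourier coefficients and Fejer's theorem *)

Section circle.
Context (R : realType).
Implicit Types (x y t : R) (n : nat) (m : int).

Lemma ee0 : ee 0 = 1 :> R[i].
Proof. by rewrite /ee mulr0 cos0 sin0. Qed.

Lemma eeD x y : ee (x + y) = ee x * ee y.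
Proof.
rewrite /ee mulrDr cosD sinD; apply/eqP; rewrite eq_complex /= eqxx/=.
by rewrite addrC.
Qed.

Lemma eeN x : ee (- x) = (ee x)^*.
Proof. by rewrite /ee mulrN cosN sinN. Qed.

Lemma normc_ee x : normc (ee x) = 1.
Proof. by rewrite /ee /= cos2Dsin2 sqrtr1. Qed.

Lemma ee_natM n x : ee (n%:R * x) = ee x ^+ n.
Proof.
elim: n => [|n IH]; first by rewrite mul0r ee0.
by rewrite -natr1 mulrDl mul1r eeD IH exprSr.
Qed.

Lemma ee_int m : ee m%:~R = 1 :> R[i].
Proof.
have ee1 : ee 1 = 1 :> R[i].
  by rewrite /ee mulr1 mulr_natl (cos2pi R) (sin2pi R).
have eeS n : ee n%:R = 1 :> R[i] by rewrite -[n%:R]mulr1 ee_natM ee1 expr1n.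
by case: m => n; rewrite ?NegzE ?mulrNz ?eeN eeS // conjc1.
Qed.

Lemma sqr_normc_ee_sub1 x : normc (ee x - 1) ^+ 2 = 2 * (1 - cos (2 * pi * x)).
Proof. by rewrite sqr_normcE /ee /=; have := cos2Dsin2 (2 * pi * x); lra. Qed.

Lemma sin_le_norm x : `|sin x| <= `|x|.
Proof.
wlog x0 : x / 0 < x => [hw|].
  have [/hw//|x0|<-] := ltgtP 0 x; last by rewrite sin0.
  by have := hw (- x); rewrite oppr_gt0 sinN !normrN; apply.
have [c _] := MVT_segment (ltW x0) (fun c _ => is_derive_sin c)
  (continuous_subspaceT (@continuous_sin R)).
by rewrite sin0 !subr0 => ->; rewrite normrM ler_piMl// cos_max.
Qed.

Lemma normc_ee_sub1_le x : normc (ee x - 1) <= 2 * pi * `|x|.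
Proof.
rewrite -[2 * pi]gtr0_norm ?mulr_gt0 ?pi_gt0// -normrM.
rewrite -ler_sqr ?nnegrE ?normc_ge0// sqr_normc_ee_sub1 real_normK ?num_real//.
have -> : 2 * pi * x = (pi * x) *+ 2 by rewrite mulr2n; ring.
have sin2 : sin (pi * x) ^+ 2 <= (pi * x) ^+ 2.
  by have := sin_le_norm (pi * x); rewrite -ler_sqr ?nnegrE// !real_normK ?num_real.
by rewrite cos_mulr2n; have := cos2Dsin2 (pi * x); rewrite !mulr2n; lra.
Qed.

Lemma continuous01_ee (u : R -> R) : continuous01 u -> Ccontinuous01 (fun t => ee (u t)).
Proof.
move=> cu; have c2piu : continuous01 (fun t => 2 * pi * u t).
  by move=> x; apply: cvgM; [exact: cvg_cst|exact: cu].
apply: continuous01_complex => x.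
  exact: continuous_comp (c2piu x) (@continuous_cos R _).
exact: continuous_comp (c2piu x) (@continuous_sin R _).
Qed.

Lemma Cintegral01_ee m : Cintegral01 (fun t => ee (m%:~R * t)) = (m == 0)%:R :> R[i].
Proof.
have [->|m0] := eqVneq m 0.
  by rewrite -[RHS]Cintegral01_cst; apply: eq_Cintegral01 => t; rewrite mul0r ee0.
pose w : R := 2 * pi * m%:~R.
have w0 : w != 0 by rewrite mulf_neq0 ?intr_eq0// gt_eqF// mulr_gt0 ?pi_gt0.
have [sinw cosw] : sin w = 0 /\ cos w = 1.
  by have := ee_int m; rewrite /ee -/w => -[-> ->].
have Icos : \int01_ t cos (w * t) = 0.
  apply: (mulfI w0); rewrite (Rintegral01_scale _ (@continuous_cos R) (@is_derive_sin R)).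
  by rewrite sinw sin0 subrr mulr0.
have Isin : \int01_ t sin (w * t) = 0.
  have dNcos x : is_derive x 1 (fun x => - cos x : R) (sin x).
    by apply: is_derive_eq (is_deriveN (is_derive_cos x)) _; rewrite opprK.
  apply: (mulfI w0); rewrite (Rintegral01_scale _ (@continuous_sin R) dNcos).
  by rewrite cosw cos0 subrr mulr0.
rewrite /Cintegral01; under eq_Rintegral do rewrite /= mulrA -/w.
by under [X in _ +i* X]eq_Rintegral do rewrite /= mulrA -/w; rewrite Icos Isin.
Qed.

End circle.

Section fourier_coefficients.
Context (R : realType).
Implicit Types (f g : R -> R[i]) (h k : int).

Lemma fourier_coefE g h : fourier_coef g h = Cintegral01 (fun t => g t * ee (- (h%:~R * t))).
Proof. by []. Qed.

Lemma continuous01_character h : Ccontinuous01 (fun t : R => ee (- (h%:~R * t))).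
Proof.
apply: continuous01_ee; apply: continuous_subspaceT => x; apply: cvgN.
by apply: cvgM; [exact: cvg_cst|exact: cvg_id].
Qed.

Lemma fourier_coefZ (c : R[i]) g h : Ccontinuous01 g ->
  fourier_coef (fun t => c * g t) h = c * fourier_coef g h.
Proof.
move=> cg; rewrite !fourier_coefE.
rewrite -(Cintegral01Z c (continuous01M cg (@continuous01_character h))).
by apply: eq_Cintegral01 => t; rewrite mulrA.
Qed.

Lemma fourier_coefB f g h : Ccontinuous01 f -> Ccontinuous01 g ->
  fourier_coef (fun t => f t - g t) h = fourier_coef f h - fourier_coef g h.
Proof.
move=> cf cg; have ch := @continuous01_character h; rewrite !fourier_coefE.
rewrite -(Cintegral01B (continuous01M cf ch) (continuous01M cg ch)).
by apply: eq_Cintegral01 => t; rewrite mulrBl.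
Qed.

Lemma fourier_coef_sum (I : Type) (r : seq I) (F : I -> R -> R[i]) h :
  (forall i, Ccontinuous01 (F i)) ->
  fourier_coef (fun t => \sum_(i <- r) F i t) h = \sum_(i <- r) fourier_coef (F i) h.
Proof.
move=> cF; have cFh i : Ccontinuous01 (fun t => F i t * ee (- (h%:~R * t))).
  exact: (continuous01M (cF i) (@continuous01_character h)).
rewrite fourier_coefE -(Cintegral01_sum r cFh).
by apply: eq_Cintegral01 => t; rewrite mulr_suml.
Qed.

Lemma fourier_coef_le g h (M : R) : Ccontinuous01 g ->
  (forall t, 0 <= t <= 1 -> normc (g t) <= M) -> normc (fourier_coef g h) <= M.
Proof.
move=> cg gM; rewrite fourier_coefE -[leRHS]Rintegral01_cst.
apply: (normc_Cintegral01_le (continuous01M cg (@continuous01_character h))) => [|t t01].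
  exact: continuous01_cst.
by rewrite normcM normc_ee mulr1 gM.
Qed.

Lemma fourier_coef_ee k h : fourier_coef (fun t : R => ee (k%:~R * t)) h = (k == h)%:R.
Proof.
rewrite fourier_coefE -subr_eq0 -Cintegral01_ee; apply: eq_Cintegral01 => t.
by rewrite -eeD -mulrBl intrB.
Qed.

Lemma fourier_coef_cst (c : R[i]) h : fourier_coef (fun=> c) h = c * (h == 0)%:R.
Proof.
rewrite eq_sym -fourier_coef_ee -fourier_coefZ; last first.
  rewrite (_ : (fun t => _) = fun=> 1); first exact: continuous01_cst.
  by apply/funext => t; rewrite mul0r ee0.
by rewrite !fourier_coefE; apply: eq_Cintegral01 => t; rewrite mul0r ee0 mulr1.
Qed.

End fourier_coefficients.

Section fejer.
Context (R : realType).
Implicit Types (f g : R -> R[i]) (x y t e r : R) (N : nat) (h : int).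

Lemma cos_far_from_int r x : 0 < r -> r <= x <= 1 - r ->
  cos (2 * pi * x) <= cos (2 * pi * r).
Proof.
move=> r0; have pi0 := @pi_gt0 R.
wlog x2 : x / x <= 2^-1 => [hw /andP[rx xr]|/andP[rx _]].
  have [x2|x2] := leP x 2^-1; first by apply: hw => //; rewrite rx.
  have -> : cos (2 * pi * x) = cos (2 * pi * (1 - x)).
    rewrite (_ : 2 * pi * x = - (2 * pi * (1 - x)) + pi *+ 2) ?cosD2pi ?cosN//.
    by rewrite mulr2n; ring.
  by apply: hw; [lra|apply/andP; split; lra].
rewrite leNgt ltr_cos ?in_itv/= -?leNgt; last 2 first.
- by apply/andP; split; nra.
- by apply/andP; split; nra.
by rewrite ler_pM2l// mulr_gt0.
Qed.

Lemma cos_lt1 r : 0 < r < 1 -> cos (2 * pi * r) < 1.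
Proof.
move=> /andP[r0 r1]; have pi0 := @pi_gt0 R.
have sin0 : 0 < sin (pi * r) by apply: sin_gt0_pi; apply/andP; split; nra.
have -> : 2 * pi * r = (pi * r) *+ 2 by rewrite mulr2n; ring.
by rewrite cos_mulr2n; have := cos2Dsin2 (pi * r); rewrite mulr2n; nra.
Qed.

Lemma periodic_uniform f e : Ccontinuous01 f -> f 0 = f 1 -> 0 < e ->
  exists2 r, 0 < r < 1 & forall t y, 0 <= t <= 1 -> 0 <= y <= 1 ->
    `|t - y| < r \/ 1 - r < `|t - y| -> normc (f t - f y) < e.
Proof.
move=> cf f01 e0; have e20 : 0 < e / 2 by rewrite divr_gt0.
have [r r0 fr] := continuous01_uniform cf e20.
have [s0 [sr s1]] : 0 < Num.min r 2^-1 /\ Num.min r 2^-1 <= r /\ Num.min r 2^-1 < 1.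
  rewrite lt_min r0 invr_gt0 ltr0n ge_min lexx gt_min; split=> //; split=> //.
  by apply/orP; right; lra.
exists (Num.min r 2^-1); first by rewrite s0.
move: (Num.min _ _) s0 sr s1 => s s0 sr s1 t y t01 y01.
wlog ty : t y t01 y01 / t <= y => [hw|].
  have [|/ltW yt] := leP t y; first exact: hw.
  by rewrite distrC normcC; exact: hw.
rewrite distrC ger0_norm ?subr_ge0// => -[near|far].
  by apply: lt_trans (fr _ _ t01 y01 _) _; rewrite 1?distrC ?ger0_norm; lra.
have i0 : 0 <= (0 : R) <= 1 by rewrite lexx ler01.
have i1 : 0 <= (1 : R) <= 1 by rewrite lexx ler01.
have ft0 : normc (f t - f 0) < e / 2.
  by apply: fr => //; rewrite subr0 ger0_norm; lra.
have fy1 : normc (f 1 - f y) < e / 2.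
  by apply: fr => //; rewrite ger0_norm; lra.
by apply: le_lt_trans (ler_distcD (f 0) _ _) _; rewrite {2}f01; lra.
Qed.

Lemma periodic_modulus f e : Ccontinuous01 f -> f 0 = f 1 -> 0 < e ->
  exists2 M, 0 <= M & forall t y, 0 <= t <= 1 -> 0 <= y <= 1 ->
    normc (f t - f y) <= e + M * (1 - cos (2 * pi * (t - y))).
Proof.
move=> cf f01 e0; have [B B0 fB] := continuous01_bounded cf.
have [r /andP[r0 r1] fr] := periodic_uniform cf f01 e0.
have c0 : 0 < 1 - cos (2 * pi * r) by rewrite subr_gt0 cos_lt1// r0.
pose M := 2 * B / (1 - cos (2 * pi * r)).
have M0 : 0 <= M by rewrite divr_ge0 ?mulr_ge0// ltW.
exists M => // t y t01 y01; rewrite -cos_norm normrM gtr0_norm ?mulr_gt0 ?pi_gt0//.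
have [near|rt] := ltP `|t - y| r; last have [far|tr] := ltP (1 - r) `|t - y|.
- apply: ler_wpDr; first by rewrite mulr_ge0// subr_ge0 cos_le1.
  by apply/ltW/fr => //; left.
- apply: ler_wpDr; first by rewrite mulr_ge0// subr_ge0 cos_le1.
  by apply/ltW/fr => //; right.
apply: ler_wpDl (ltW e0) _; apply: (@le_trans _ _ (2 * B)).
  apply: le_trans (le_normcD _ _) _; rewrite normcN.
  by have := fB _ t01; have := fB _ y01; lra.
rewrite /M mulrAC ler_pdivlMr// ler_wpM2l ?mulr_ge0 ?(ltW B0)// lerB//.
by apply: cos_far_from_int => //; rewrite rt.
Qed.

Definition fejer_kernel N x : R := normc (\sum_(k < N) ee (k%:R * x)) ^+ 2.

Lemma fejer_kernelE N x : (fejer_kernel N x)%:C =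
  \sum_(j < N) \sum_(k < N) ee ((j%:Z - k%:Z)%:~R * x).
Proof.
rewrite /fejer_kernel -mulcJ (raddf_sum (@conjc R)) big_distrlr.
apply: eq_bigr => j _; apply: eq_bigr => k _.
by rewrite intrB mulrBl eeD eeN.
Qed.

Lemma fejer_kernel_le N x : fejer_kernel N x * (1 - cos (2 * pi * x)) <= 2.
Proof.
have geom : (ee x - 1) * \sum_(k < N) ee (k%:R * x) = ee (N%:R * x) - 1.
  by rewrite ee_natM subrX1; congr (_ * _); apply: eq_bigr => k _; rewrite ee_natM.
have := congr1 (fun z => normc z ^+ 2) geom.
rewrite normcM exprMn !sqr_normc_ee_sub1 -/(fejer_kernel N x).
by have := cos_geN1 (2 * pi * (N%:R * x)); lra.
Qed.

(* Indexed by differences, so that each frequency [h] gets the Fejer weight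
   [(N - |h|) / N]. *)
Definition fejer_mean N g t : R[i] := N%:R^-1 *
  \sum_(j < N) \sum_(k < N)
    fourier_coef g (j%:Z - k%:Z) * ee ((j%:Z - k%:Z)%:~R * t).

Lemma continuous01_fejer_kernel N t :
  Ccontinuous01 (fun y => (fejer_kernel N (t - y))%:C).
Proof.
rewrite (_ : (fun y => _) = fun y =>
  \sum_(j < N) \sum_(k < N) ee ((j%:Z - k%:Z)%:~R * (t - y))); last first.
  by apply/funext => y; rewrite fejer_kernelE.
do 2!apply: continuous01_sum => ?; apply: continuous01_ee.
apply: continuous_subspaceT => x; apply: cvgM; first exact: cvg_cst.
by apply: cvgB; [exact: cvg_cst|exact: cvg_id].
Qed.

Lemma fejer_convolution N g t : (0 < N)%N -> Ccontinuous01 g ->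
  Cintegral01 (fun y => g y * (fejer_kernel N (t - y))%:C) = N%:R * fejer_mean N g t.
Proof.
move=> N0 cg; rewrite mulrA divff ?pnatr_eq0 -?lt0n// mul1r.
pose F (j k : 'I_N) y := ee ((j%:Z - k%:Z)%:~R * t) * (g y * ee (- ((j%:Z - k%:Z)%:~R * y))).
have cF j k : Ccontinuous01 (F j k).
  exact/continuous01Z/continuous01M/continuous01_character.
transitivity (Cintegral01 (fun y => \sum_j \sum_k F j k y)).
  apply: eq_Cintegral01 => y; rewrite fejer_kernelE mulr_sumr; apply: eq_bigr => j _.
  rewrite mulr_sumr; apply: eq_bigr => k _.
  by rewrite mulrBr eeD /F mulrCA.
rewrite (Cintegral01_sum _ (fun j => continuous01_sum (cF j))); apply: eq_bigr => j _.
rewrite (Cintegral01_sum _ (cF j)); apply: eq_bigr => k _.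
rewrite /F (Cintegral01Z _ (continuous01M cg (@continuous01_character R _))).
by rewrite mulrC fourier_coefE.
Qed.

Lemma fejer_kernel_mass N t : (0 < N)%N -> \int01_ y fejer_kernel N (t - y) = N%:R.
Proof.
move=> N0; apply: complexI; rewrite -Cintegral01_real rmorph_nat.
transitivity (Cintegral01 (fun y => 1 * (fejer_kernel N (t - y))%:C)).
  by apply: eq_Cintegral01 => y; rewrite mul1r.
rewrite (fejer_convolution t N0 (@continuous01_cst R (R[i])^o 1)).
rewrite mulrA divff ?pnatr_eq0 -?lt0n// mul1r.
transitivity (\sum_(j < N) (1 : R[i])); last by rewrite sumr_const card_ord.
apply: eq_bigr => j _; rewrite (bigD1 j)//= fourier_coef_cst subrr eqxx mul0r ee0 !mulr1.
rewrite big1 ?addr0// => k kj.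
by rewrite fourier_coef_cst subr_eq0 eqz_nat (inj_eq val_inj) eq_sym (negbTE kj) mulr0 mul0r.
Qed.

Lemma fejer_theorem g e : Ccontinuous01 g -> g 0 = g 1 -> 0 < e ->
  exists2 N, (0 < N)%N & forall t, 0 <= t <= 1 -> normc (fejer_mean N g t - g t) <= e.
Proof.
move=> cg g01 e0; have e20 : 0 < e / 2 by rewrite divr_gt0.
have [M M0 gM] := periodic_modulus cg g01 e20.
pose N := (Num.truncn (4 * M / e)).+1; exists N => // t t01.
have N0 : 0 < N%:R :> R by rewrite ltr0n.
have NM : 2 * M <= N%:R * (e / 2).
  by have := truncnS_gt (4 * M / e); rewrite -/N ltr_pdivrMr//; lra.
have cK : Ccontinuous01 (fun y => (fejer_kernel N (t - y))%:C) := @continuous01_fejer_kernel N t.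
have cKr : continuous01 (fun y => fejer_kernel N (t - y)) := continuous01_Re cK.
have cgt : Ccontinuous01 (fun=> g t) := @continuous01_cst R (R[i])^o (g t).
rewrite -(ler_pM2l N0).
have gtE : N%:R * g t = Cintegral01 (fun y => g t * (fejer_kernel N (t - y))%:C).
  by rewrite (Cintegral01Z _ cK) Cintegral01_real fejer_kernel_mass// rmorph_nat mulrC.
have -> : N%:R * normc (fejer_mean N g t - g t) =
    normc (Cintegral01 (fun y => (g y - g t) * (fejer_kernel N (t - y))%:C)).
  rewrite -[X in X * _]ger0_norm// -normcR -normcM rmorph_nat mulrBr.
  rewrite gtE -(fejer_convolution t (ltn0Sn _) cg).
  rewrite -(Cintegral01B (continuous01M cg cK) (continuous01Z cK)).
  by congr normc; apply: eq_Cintegral01 => y; rewrite mulrBl.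
apply: (@le_trans _ _ (\int01_ y (e / 2 * fejer_kernel N (t - y) + 2 * M))).
  apply: (normc_Cintegral01_le (continuous01M (continuous01B cg cgt) cK)) => [x|y y01].
    apply: cvgD; last exact: cvg_cst.
    by apply: cvgM; [exact: cvg_cst|exact: cKr].
  rewrite normcM normcR ger0_norm ?sqr_ge0// normcC.
  have K0 : 0 <= fejer_kernel N (t - y) by exact: sqr_ge0.
  have := ler_wpM2r K0 (gM _ _ t01 y01).
  by have := ler_wpM2l M0 (fejer_kernel_le N (t - y)); lra.
have iK := continuous01_integrable cKr.
have iZ : (@lebesgue_measure R).-integrable `[0%R, 1%R]
  (EFin \o (fun y => e / 2 * fejer_kernel N (t - y))) by exact: (integrableZl _ (e / 2) iK).
rewrite (RintegralD _ iZ (continuous01_integrable (@continuous01_cst R R (2 * M))))//.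
by rewrite RintegralZl// fejer_kernel_mass// Rintegral01_cst; lra.
Qed.

End fejer.

(** * Trigonometric paths *)

Section sums_over_integers.
Context (V : nmodType).
Implicit Types (h : int) (N : nat).

Lemma sum_paired_indicator (y : V) h N : h != 0 ->
  \sum_(1 <= n < N) ((if Posz n == h then y else 0) + (if - Posz n == h then y else 0)) =
  if (`|h| < N)%N then y else 0.
Proof.
move=> h0; have {h0} habs : (0 < `|h|)%N by rewrite absz_gt0.
elim: N => [|[|N] IH]; first by rewrite big_geq.
  by rewrite big_geq// ltnS leqn0 eqn0Ngt habs.
rewrite big_nat_recr//= IH [in RHS]ltnS [in RHS]leq_eqVlt.
have [hN|hN] /= := eqVneq `|h|%N N.+1; last first.
  have /negbTE -> : Posz N.+1 != h by apply: contraNneq hN => <-.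
  have /negbTE -> : - Posz N.+1 != h by apply: contraNneq hN => <-; rewrite abszN.
  by rewrite !addr0.
rewrite hN ltnn add0r; case: h {habs IH} hN => [n /= ->|n /= [->]]; first by rewrite eqxx addr0.
by rewrite NegzE eqxx add0r.
Qed.

Lemma sum_differences (a : int -> V) N :
  \sum_(j < N) \sum_(k < N) a (j%:Z - k%:Z) =
  a 0 *+ N + \sum_(1 <= n < N) (a (Posz n) + a (- Posz n)) *+ (N - n).
Proof.
elim: N => [|N IH]; first by rewrite big_ord0 big_geq// mulr0n addr0.
have new_row : \sum_(j < N) (a (j%:Z - N%:Z) + a (N%:Z - j%:Z)) =
    \sum_(1 <= n < N.+1) (a (Posz n) + a (- Posz n)).
  rewrite big_add1/= big_mkord (reindex_inj rev_ord_inj); apply: eq_bigr => j _ /=.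
  by rewrite addrC; congr (a _ + a _); have := ltn_ord j; lia.
rewrite big_ord_recr/= big_ord_recr/= subrr.
under eq_bigr do rewrite big_ord_recr/=.
rewrite big_split/= IH mulrSr -!addrA; congr (_ + _).
rewrite [X in _ + X]addrA -big_split/= new_row addrA addrC; congr (_ + _).
have -> : \sum_(1 <= n < N) (a (Posz n) + a (- Posz n)) *+ (N - n) =
    \sum_(1 <= n < N.+1) (a (Posz n) + a (- Posz n)) *+ (N - n).
  case: N {IH new_row} => [|N]; first by rewrite !big_geq.
  by rewrite [RHS]big_nat_recr//= subnn mulr0n addr0.
rewrite -big_split/= big_nat [RHS]big_nat; apply: eq_bigr => n /andP[_ nN].
by rewrite subSn// mulrSr addrC.
Qed.

End sums_over_integers.

Section integrated_characters.
Context (R : realType).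
Implicit Types (t s : R) (h k : int).

Definition angular_frequency h : R := 2 * pi * h%:~R.
Local Notation freq := angular_frequency.

(* [e(h t)] integrated from [0] to [t] when [h != 0]; the value at [h = 0] is [0]. *)
Definition integrated_character h t : R[i] :=
  (ee (h%:~R * t) - 1) / ((freq h)%:C * 'i).
Local Notation ichar := integrated_character.

Lemma freq_neq0 h : h != 0 -> freq h != 0.
Proof. by move=> h0; rewrite mulf_neq0 ?intr_eq0// gt_eqF// mulr_gt0 ?pi_gt0. Qed.

Lemma ifreq_eq0 h : ((freq h)%:C * 'i == 0 :> R[i]) = (h == 0).
Proof.
rewrite mulf_eq0 [_ == 0]eq_complex /= eqxx andbT.
rewrite [X in _ || X]eq_complex /= oner_eq0 andbF orbF.
by have [->|/freq_neq0/negbTE//] := eqVneq h 0; rewrite /freq mulr0 eqxx.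
Qed.

Lemma norm_freq h : `|freq h| = 2 * pi * `|h|%:~R.
Proof. by rewrite normrM gtr0_norm ?mulr_gt0 ?pi_gt0// intr_norm. Qed.

Lemma normc_ifreq h : normc ((freq h)%:C * 'i) = 2 * pi * `|h|%:~R.
Proof. by rewrite normcM normcR /= expr0n expr1n add0r sqrtr1 mulr1 norm_freq. Qed.

Lemma ifreqM_ichar h t : (freq h)%:C * 'i * ichar h t = ee (h%:~R * t) - 1.
Proof.
have [->|h0] := eqVneq h 0; first by rewrite /freq mulr0 !mul0r ee0 subrr.
by rewrite mulrC divfK// ifreq_eq0.
Qed.

Lemma integrated_character0 h : ichar h 0 = 0.
Proof. by rewrite /ichar mulr0 ee0 subrr mul0r. Qed.

Lemma integrated_character1 h : ichar h 1 = 0.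
Proof. by rewrite /ichar mulr1 ee_int subrr mul0r. Qed.

Lemma integrated_character_lipschitz h t s : normc (ichar h t - ichar h s) <= `|t - s|.
Proof.
have [->|h0] := eqVneq h 0.
  by rewrite /ichar !mul0r subrr normc0.
have w0 : 0 < 2 * pi * `|h|%:~R :> R by rewrite !mulr_gt0 ?pi_gt0// ltr0z normr_gt0.
rewrite -mulrBl opprB addrA subrK normcM normcV normc_ifreq ler_pdivrMr//.
have -> : ee (h%:~R * t) - ee (h%:~R * s) = ee (h%:~R * s) * (ee (h%:~R * (t - s)) - 1).
  by rewrite mulrBr mulr1 -eeD mulrBr subrKC.
rewrite normcM normc_ee mul1r; apply: le_trans (normc_ee_sub1_le _) _.
by rewrite normrM intr_norm; lra.
Qed.

Lemma integrated_character_le h t : h != 0 -> normc (ichar h t) <= `|h|%:~R^-1.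
Proof.
move=> h0; have n0 : 0 < `|h|%:~R :> R by rewrite ltr0z normr_gt0.
have w0 : 0 < 2 * pi * `|h|%:~R :> R by rewrite !mulr_gt0 ?pi_gt0.
rewrite normcM normcV normc_ifreq ler_pdivrMr// mulrA mulrAC mulVf ?gt_eqF// mul1r.
apply: le_trans (le_normcD _ _) _; rewrite normc_ee normcN normc1.
by have := @pi_ge2 R; lra.
Qed.

Lemma continuous01_ichar h : Ccontinuous01 (ichar h).
Proof.
apply/Ccontinuous01P => t _ e e0; exists e => // y _ ty.
exact: le_lt_trans (integrated_character_lipschitz _ _ _) ty.
Qed.

Lemma fourier_coef_ichar k h : h != 0 ->
  fourier_coef (ichar k) h = (k == h)%:R / ((freq h)%:C * 'i).
Proof.
move=> h0; pose w := ((freq k)%:C * 'i)^-1.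
have c0 : Ccontinuous01 (fun t => ee (k%:~R * t)).
  apply: continuous01_ee; apply: continuous_subspaceT => x.
  by apply: cvgM; [exact: cvg_cst|exact: cvg_id].
have c1 : Ccontinuous01 (fun=> 1 : R[i]) := @continuous01_cst R (R[i])^o 1.
rewrite (_ : ichar k = fun t => w * (ee (k%:~R * t) - 1)); last first.
  by apply/funext => t; rewrite /ichar mulrC.
rewrite (fourier_coefZ _ _ (continuous01B c0 c1)) (fourier_coefB _ c0 c1).
rewrite fourier_coef_ee fourier_coef_cst (negbTE h0) mulr0 subr0 mulrC /w.
by have [->|] := eqVneq k h; rewrite ?mul0r.
Qed.

End integrated_characters.

Section trigonometric_paths.
Context (R : realType).
Implicit Types (x : int -> R) (t s : R) (h k : int) (L M N : nat).
Local Notation ichar := (@integrated_character R).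
Local Notation freq := (@angular_frequency R).

Definition paired_sum x M N t : R[i] :=
  \sum_(M <= n < N) (ichar (Posz n) t * (x (Posz n))%:C + ichar (- Posz n) t * (x (- Posz n))%:C).

Definition trig_path x N t : R[i] := (t * x 0)%:C + paired_sum x 1 N.+1 t.

Lemma K_partialE (T : Type) (ST : int -> T -> R) N w : K_partial ST N w = trig_path (ST^~ w) N.
Proof. by []. Qed.

Lemma continuous01_paired_sum x M N : Ccontinuous01 (paired_sum x M N).
Proof.
have cM h : Ccontinuous01 (fun t => ichar h t * (x h)%:C).
  exact: (continuous01M (@continuous01_ichar R h) (@continuous01_cst R (R[i])^o _)).
by apply: continuous01_sum => n; exact: (continuous01D (cM _) (cM _)).
Qed.

Lemma continuous01_real (u : R -> R) : continuous01 u -> Ccontinuous01 (fun t => (u t)%:C).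
Proof. by move=> cu; exact: (continuous01_complex cu (@continuous01_cst R R 0)). Qed.

Lemma continuous01_trig_path x N : Ccontinuous01 (trig_path x N).
Proof.
apply: continuous01D; last exact: continuous01_paired_sum.
apply: continuous01_real; apply: continuous_subspaceT => t.
by apply: cvgM; [exact: cvg_id|exact: cvg_cst].
Qed.

Lemma trig_path0 x N : trig_path x N 0 = 0.
Proof.
rewrite /trig_path mul0r add0r /paired_sum big1// => n _.
by rewrite !integrated_character0 !mul0r addr0.
Qed.

Lemma trig_path1 x N : trig_path x N 1 = (x 0)%:C.
Proof.
rewrite /trig_path mul1r /paired_sum big1 ?addr0// => n _.
by rewrite !integrated_character1 !mul0r addr0.
Qed.

Lemma trig_path_bridge x N t : trig_path x N t - t%:C * trig_path x N 1 = paired_sum x 1 N.+1 t.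
Proof. by rewrite trig_path1 /trig_path rmorphM addrAC subrr add0r. Qed.

Lemma fourier_coef_paired_sum x N h : h != 0 ->
  fourier_coef (paired_sum x 1 N) h =
  (if (`|h| < N)%N then x h else 0)%:C / ((freq h)%:C * 'i).
Proof.
move=> h0; have cM k : Ccontinuous01 (fun t => ichar k t * (x k)%:C).
  exact: (continuous01M (@continuous01_ichar R k) (@continuous01_cst R (R[i])^o _)).
have coefM k : fourier_coef (fun t => ichar k t * (x k)%:C) h =
    (if k == h then x h else 0)%:C / ((freq h)%:C * 'i).
  rewrite (_ : (fun t => _) = fun t => (x k)%:C * ichar k t); last first.
    by apply/funext => t; rewrite mulrC.
  rewrite (fourier_coefZ _ _ (@continuous01_ichar R k)) fourier_coef_ichar//.
  by case: eqP => [->|_]; rewrite ?mul1r ?mul0r ?mulr0.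
have cF n : Ccontinuous01 (fun t => ichar (Posz n) t * (x (Posz n))%:C +
    ichar (- Posz n) t * (x (- Posz n))%:C) := continuous01D (cM _) (cM _).
rewrite /paired_sum (fourier_coef_sum _ _ cF) -(sum_paired_indicator _ _ h0).
rewrite rmorph_sum mulr_suml; apply: eq_bigr => n _; rewrite rmorphD mulrDl -!coefM.
rewrite !fourier_coefE -(Cintegral01D (continuous01M (cM _) (@continuous01_character R _))
  (continuous01M (cM _) (@continuous01_character R _))).
by apply: eq_Cintegral01 => t; rewrite mulrDl.
Qed.

End trigonometric_paths.

Section admissible_paths.
Context (R : realType).
Implicit Types (f : R -> R[i]) (x : int -> R) (e t : R) (h : int).
Local Notation ichar := (@integrated_character R).
Local Notation freq := (@angular_frequency R).

Definition bridge f t : R[i] := f t - t%:C * f 1.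

Definition admissible f : Prop :=
  [/\ f 0 = 0,
      exists x : R, -2 <= x <= 2 /\ f 1 = x%:C
    & forall h : int, h != 0 ->
        complex.Re (fourier_coef (bridge f) h) = 0 /\
        `|fourier_coef (bridge f) h| <= ((pi * `|h|%:~R)^-1)%:C].

Definition approximable f : Prop := forall e, 0 < e -> exists N x,
  (forall h, `|x h| <= 2) /\
  forall t, 0 <= t <= 1 -> normc (f t - trig_path x N t) <= e.

Lemma le_coef_boundE (a : R) h : h != 0 ->
  (a <= (pi * `|h|%:~R)^-1) = (`|freq h| * a <= 2).
Proof.
move=> h0; have n0 : 0 < pi * `|h|%:~R :> R by rewrite mulr_gt0 ?pi_gt0// ltr0z normr_gt0.
rewrite -[X in a <= X]mul1r ler_pdivlMr// norm_freq.
by move: (`|h|%:~R : R) {n0} => n; apply/idP/idP => ?; lra.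
Qed.

Lemma trig_path_admissible x N : (forall h, `|x h| <= 2) -> admissible (trig_path x N).
Proof.
move=> x2; split; first exact: trig_path0.
  by exists (x 0); rewrite trig_path1 -ler_norml.
move=> h h0; rewrite (_ : bridge _ = paired_sum x 1 N.+1); last first.
  by apply/funext => t; exact: trig_path_bridge.
rewrite fourier_coef_paired_sum//; have w0 := freq_neq0 R h0.
have : `|if (`|h| < N.+1)%N then x h else 0| <= 2 by case: ifP; rewrite ?normr0.
move: (if _ then _ else _) => y y2.
have -> : y%:C / ((freq h)%:C * 'i) = 0 +i* (- (y / freq h)).
  apply: (canLR (mulfK _)); first by rewrite ifreq_eq0.
  by apply/eqP; rewrite eq_complex /=; apply/andP; split; apply/eqP; field.
split=> //; rewrite normr_normc lecR le_coef_boundE//.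
by rewrite /= expr0n add0r sqrtr_sqr normrN -normrM mulrC divfK.
Qed.

Lemma continuous01_bridge f : Ccontinuous01 f -> Ccontinuous01 (bridge f).
Proof.
move=> cf; apply: (continuous01B cf).
apply: continuous01M; last exact: (@continuous01_cst R (R[i])^o).
by apply: continuous01_real; apply: continuous_subspaceT => t; exact: cvg_id.
Qed.

Lemma fourier_coef_bridge_dist f k e h : Ccontinuous01 f -> Ccontinuous01 k ->
  (forall t, 0 <= t <= 1 -> normc (f t - k t) <= e) ->
  normc (fourier_coef (bridge f) h - fourier_coef (bridge k) h) <= 2 * e.
Proof.
move=> cf ck fk; have [cbf cbk] := (continuous01_bridge cf, continuous01_bridge ck).
rewrite -(fourier_coefB h cbf cbk); apply: (fourier_coef_le _ (continuous01B cbf cbk)) => t t01.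
have -> : bridge f t - bridge k t = f t - k t - t%:C * (f 1 - k 1).
  by rewrite /bridge; ring.
apply: le_trans (le_normcD _ _) _; rewrite normcN normcM normcR.
have fk1 : normc (f 1 - k 1) <= e by apply: fk; rewrite lexx ler01.
have := fk _ t01; move: t01 => /andP[t0 t1]; rewrite (ger0_norm t0).
by have := ler_wpM2r (normc_ge0 (f 1 - k 1)) t1; lra.
Qed.

Lemma eq0_normc_le (z : R[i]) : (forall e, 0 < e -> normc z <= e) -> z = 0.
Proof.
move=> z_le; apply: eq0_normc; apply/eqP; rewrite eq_le normc_ge0 andbT.
by apply/ler_addgt0Pr => e /z_le; rewrite add0r.
Qed.

Lemma admissible_closed f : Ccontinuous01 f ->
  (forall e, 0 < e -> exists k, [/\ Ccontinuous01 k, admissible k &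
     forall t, 0 <= t <= 1 -> normc (f t - k t) <= e]) ->
  admissible f.
Proof.
move=> cf approx; split.
- apply: eq0_normc_le => e /approx[k [_ [k0 _ _] fk]].
  by rewrite -[f 0]subr0 -k0; apply: fk; rewrite lexx ler01.
- have near1 e : 0 < e -> exists2 x : R, `|x| <= 2 & normc (f 1 - x%:C) <= e.
    move=> /approx[k [_ [_ [x [x2 k1]] _] fk]].
    by exists x; rewrite ?ler_norml// -k1; apply: fk; rewrite lexx ler01.
  have Im0 : complex.Im (f 1) = 0.
    apply/eqP; rewrite -normr_le0; apply/ler_addgt0Pr => e /near1[x _]; rewrite add0r.
    by apply: le_trans; apply: le_trans (Im_le_normc _); rewrite ImB subr0.
  exists (complex.Re (f 1)); split; last by rewrite [LHS]complexE Im0 mulr0 addr0.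
  rewrite -ler_norml; apply/ler_addgt0Pr => e /near1[x x2 fx].
  have := le_trans (Re_le_normc _) fx; rewrite ReB /=.
  by have := ler_distD x (complex.Re (f 1)) 0; rewrite !subr0; lra.
move=> h h0; have near_coef e : 0 < e -> exists z : R[i], [/\ complex.Re z = 0,
    normc z <= (pi * `|h|%:~R)^-1 & normc (fourier_coef (bridge f) h - z) <= e].
  move=> e0; have e20 : 0 < e / 2 by rewrite divr_gt0.
  have [k [ck [_ _ /(_ _ h0)[Re0 le_k]] fk]] := approx _ e20.
  exists (fourier_coef (bridge k) h); split=> //; first by rewrite -lecR.
  by have := fourier_coef_bridge_dist h cf ck fk; lra.
split.
  apply/eqP; rewrite -normr_le0; apply/ler_addgt0Pr => e /near_coef[z [z0 _]]; rewrite add0r.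
  by apply: le_trans; apply: le_trans (Re_le_normc _); rewrite ReB z0 subr0.
rewrite normr_normc lecR; apply/ler_addgt0Pr => e /near_coef[z [_ z_le fz]].
by have := ler_distcD z (fourier_coef (bridge f) h) 0; rewrite !subr0; lra.
Qed.

(* The coefficients of the trigonometric path whose bridge is the Fejer mean of
   the bridge of [f], shifted to vanish at [0]. *)
Definition fejer_path_coef N f h : R :=
  if h == 0 then complex.Re (f 1) else
  - ((N - `|h|)%:R / N%:R * (freq h * complex.Im (fourier_coef (bridge f) h))).

Lemma fejer_path_coef_le N f h : admissible f -> `|fejer_path_coef N f h| <= 2.
Proof.
move=> [_ [x [x2 f1]] coef]; rewrite /fejer_path_coef.
case: eqVneq => [_|h0]; first by rewrite f1 ler_norml.
have [_] := coef _ h0; rewrite normr_normc lecR => /(le_trans (Im_le_normc _)).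
rewrite le_coef_boundE// => Im_le; rewrite normrN normrM [X in _ * X]normrM.
apply: le_trans Im_le; rewrite ler_piMl ?mulr_ge0// ger0_norm ?divr_ge0//.
case: N => [|N]; first by rewrite invr0 mulr0.
by rewrite ler_pdivrMr// mul1r ler_nat leq_subr.
Qed.

Lemma fejer_mean_bridge N f t : admissible f ->
  fejer_mean N (bridge f) t - fejer_mean N (bridge f) 0 =
  paired_sum (fejer_path_coef N f) 1 N t.
Proof.
move=> [_ _ coef]; rewrite /fejer_mean -mulrBr -sumrB.
under eq_bigr => j _ do (rewrite -sumrB; under eq_bigr do rewrite mulr0 ee0 -mulrBr).
rewrite (sum_differences (fun h => fourier_coef (bridge f) h * (ee (h%:~R * t) - 1))).
rewrite mul0r ee0 subrr mulr0 mul0rn add0r mulr_sumr.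
have term h : h != 0 -> N%:R^-1 * (fourier_coef (bridge f) h * (ee (h%:~R * t) - 1)
    *+ (N - `|h|)) = ichar h t * (fejer_path_coef N f h)%:C.
  move=> h0; have -> : (fejer_path_coef N f h)%:C = ((N - `|h|)%:R / N%:R) *
      ((freq h)%:C * 'i * fourier_coef (bridge f) h).
    have -> : (N - `|h|)%:R / N%:R = ((N - `|h|)%:R / N%:R)%:C :> R[i].
      by rewrite rmorphM fmorphV !rmorph_nat.
    rewrite /fejer_path_coef (negbTE h0); have [+ _] := coef _ h0.
    case: (fourier_coef _ _) => a b /= ->; apply/eqP; rewrite eq_complex /=.
    by apply/andP; split; apply/eqP; ring.
  by rewrite -ifreqM_ichar -[_ *+ (N - _)]mulr_natl; ring.
rewrite big_nat [RHS]big_nat; apply: eq_bigr => n /andP[n0 _].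
by rewrite mulrnDl mulrDr -!term// ?abszN// ?oppr_eq0 -lt0n.
Qed.

Lemma admissible_approximable f : Ccontinuous01 f -> admissible f -> approximable f.
Proof.
move=> cf adm e e0; have cg := continuous01_bridge cf.
have [f0 [x [x2 f1]] _] := adm.
have [g0 g1] : bridge f 0 = 0 /\ bridge f 1 = 0.
  by rewrite /bridge f0 mul0r mul1r !subrr.
have e20 : 0 < e / 2 by rewrite divr_gt0.
have [N N0 fejer] := fejer_theorem cg (etrans g0 (esym g1)) e20.
exists N.-1, (fejer_path_coef N f); split=> [h|t t01]; first exact: fejer_path_coef_le.
have -> : f t - trig_path (fejer_path_coef N f) N.-1 t =
    (bridge f t - fejer_mean N (bridge f) t) + (fejer_mean N (bridge f) 0 - bridge f 0).
  rewrite /trig_path prednK// -fejer_mean_bridge// g0 /bridge f1 rmorphM.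
  by rewrite /fejer_path_coef eqxx f1; ring.
apply: le_trans (le_normcD _ _) _; rewrite normcC.
by have := fejer t t01; have := fejer 0; rewrite lexx ler01 => /(_ isT); lra.
Qed.

Lemma admissibleP f : Ccontinuous01 f -> admissible f <-> approximable f.
Proof.
move=> cf; split=> [|approx]; first exact: admissible_approximable.
apply: (admissible_closed cf) => e /approx[N [x [x2 fx]]].
by exists (trig_path x N); split; [exact: continuous01_trig_path|exact: trig_path_admissible|].
Qed.

End admissible_paths.

(** * Uniform limits of random functions *)

Section uniform_limits.
Context (R : realType).
Implicit Types (F : nat -> R -> R[i]) (f k : R -> R[i]) (e t : R) (m n p M N : nat).

Definition uniform_limit01 F k := forall e, 0 < e -> exists N0, forall N, (N0 <= N)%N ->
  forall t, 0 <= t <= 1 -> normc (F N t - k t) < e.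

Definition uniform_cauchy01 F := forall p, exists N0, forall N M, (N0 <= N)%N -> (N0 <= M)%N ->
  forall t, 0 <= t <= 1 -> normc (F N t - F M t) <= p.+1%:R^-1.

Lemma inv_succ_lt e : 0 < e -> exists p, p.+1%:R^-1 < e.
Proof.
move=> e0; exists (Num.truncn e^-1).
by rewrite -[ltRHS]invrK ltf_pV2 ?posrE ?invr_gt0//; exact: truncnS_gt.
Qed.

Lemma complex_cauchy_cvg (z : nat -> R[i]) :
  (forall e, 0 < e -> exists N0, forall N M, (N0 <= N)%N -> (N0 <= M)%N ->
     normc (z N - z M) < e) ->
  exists l, forall e, 0 < e -> exists N0, forall N, (N0 <= N)%N -> normc (z N - l) < e.
Proof.
move=> cauchy_z.
have cvg_part (g : R[i] -> R) : (forall u v, `|g u - g v| <= normc (u - v)) ->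
    cvgn (fun n => g (z n)).
  move=> g_le; apply/cauchy_cvgP/cauchy_exP => e /cauchy_z[N0 zN].
  exists (g (z N0)), N0 => //= N N0N.
  by apply: le_lt_trans (g_le _ _) _; exact: zN.
have /cvgrPdist_lt cRe : cvgn (fun n => complex.Re (z n)).
  by apply: cvg_part => u v; rewrite -ReB; exact: Re_le_normc.
have /cvgrPdist_lt cIm : cvgn (fun n => complex.Im (z n)).
  by apply: cvg_part => u v; rewrite -ImB; exact: Im_le_normc.
exists (limn (fun n => complex.Re (z n)) +i* limn (fun n => complex.Im (z n))) => e e0.
have e20 : 0 < e / 2 by rewrite divr_gt0.
have [N1 _ zRe] := cRe _ e20; have [N2 _ zIm] := cIm _ e20.
exists (maxn N1 N2) => N; rewrite geq_max => /andP[/zRe/= zReN /zIm/= zImN].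
rewrite normcC; apply: le_lt_trans (normc_le_ReIm _) _; rewrite ReB ImB /=.
by lra.
Qed.

Lemma uniform_cauchy01P F : (exists k, uniform_limit01 F k) <-> uniform_cauchy01 F.
Proof.
split=> [[k Fk] p|cauchy_F].
  have p0 : 0 < p.+1%:R^-1 / 2 :> R by rewrite divr_gt0.
  have [N0 FN] := Fk _ p0; exists N0 => N M N0N N0M t t01.
  apply: le_trans (ler_distcD (k t) _ _) _; rewrite (normcC (k t)).
  by have := FN _ N0N _ t01; have := FN _ N0M _ t01; move: (_^-1) => e; lra.
have /choice[k Fk] : forall t, exists l, 0 <= t <= 1 -> forall e, 0 < e ->
    exists N0, forall N, (N0 <= N)%N -> normc (F N t - l) < e.
  move=> t; have [t01|] := boolP (0 <= t <= 1); last by exists 0.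
  have [e e0|l Fl] := @complex_cauchy_cvg (fun N => F N t); last by exists l.
  have [p pe] := inv_succ_lt e0; have [N0 FN] := cauchy_F p.
  by exists N0 => N M N0N N0M; apply: le_lt_trans (FN _ _ N0N N0M _ t01) pe.
exists k => e e0; have [p pe] := inv_succ_lt e0; have [N0 FN] := cauchy_F p.
exists N0 => N N0N t t01; apply: le_lt_trans pe; apply/ler_addgt0Pr => d d0.
have [M0 Fkt] := Fk _ t01 _ d0.
have := FN _ (maxn N0 M0) N0N (leq_maxl _ _) _ t01; have := Fkt _ (leq_maxr N0 M0).
by have := ler_distcD (F (maxn N0 M0) t) (F N t) (k t); move: (_^-1) => ?; lra.
Qed.

Lemma continuous01_uniform_limit F k : (forall N, Ccontinuous01 (F N)) ->
  uniform_limit01 F k -> Ccontinuous01 k.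
Proof.
move=> cF Fk; apply: continuous01_approx => e /Fk[N FN].
by exists (F N) => // t t01; rewrite normcC FN.
Qed.

Lemma sup_ball_uniform_limitP F f k (eps : R) :
  (forall N, Ccontinuous01 (F N)) -> Ccontinuous01 f -> uniform_limit01 F k ->
  sup_ball f eps k <-> exists p N0, forall N, (N0 <= N)%N -> forall t, 0 <= t <= 1 ->
    normc (F N t - f t) <= eps - p.+1%:R^-1.
Proof.
move=> cF cf Fk; split=> [kf|[p [N0 Ff]] t].
  have ck := continuous01_uniform_limit cF Fk.
  have [c c01 maxc] := EVT_max ler01 (continuous01_normc (continuous01B ck cf)).
  have gap0 : 0 < (eps - normc (k c - f c)) / 2.
    by rewrite divr_gt0// subr_gt0 -ltcR; exact: kf.
  have [p pgap] := inv_succ_lt gap0; have [N0 FN] := Fk _ gap0.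
  exists p, N0 => N N0N t t01; have := ler_distcD (k t) (F N t) (f t).
  have := FN _ N0N _ t01; have := maxc t; rewrite in_itv/= t01 => /(_ isT).
  by move: (_^-1) pgap => ?; lra.
rewrite in_itv/= => t01; rewrite normr_normc ltcR.
have p0 : 0 < p.+1%:R^-1 :> R by rewrite invr_gt0.
have [N1 FN] := Fk _ p0; have := Ff _ (leq_maxl N0 N1) _ t01.
have := FN _ (leq_maxr N0 N1) _ t01; have := ler_distcD (F (maxn N0 N1) t) (k t) (f t).
by rewrite (normcC _ (k t)); move: (_^-1) => ?; lra.
Qed.

Lemma uniform_limit_sup_ballP F f (eps : R) :
  (forall N, Ccontinuous01 (F N)) -> Ccontinuous01 f ->
  (exists k, uniform_limit01 F k /\ sup_ball f eps k) <->
  uniform_cauchy01 F /\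
  (exists p N0, forall N, (N0 <= N)%N -> forall t, 0 <= t <= 1 ->
     normc (F N t - f t) <= eps - p.+1%:R^-1).
Proof.
move=> cF cf; split=> [[k [Fk /(sup_ball_uniform_limitP eps cF cf Fk) near_f]]|].
  by split=> //; apply/uniform_cauchy01P; exists k.
move=> [/uniform_cauchy01P[k Fk] near_f].
by exists k; split=> //; apply/(sup_ball_uniform_limitP eps cF cf Fk).
Qed.

Lemma grid_approx t n : (0 < n)%N -> 0 <= t <= 1 ->
  exists2 j, (j <= n)%N & `|t - j%:R / n%:R| <= n%:R^-1.
Proof.
move=> n0 /andP[t0 t1]; have {}n0 : 0 < n%:R :> R by rewrite ltr0n.
have tn0 : 0 <= t * n%:R by rewrite mulr_ge0// ltW.
have trunc_le : (Num.truncn (t * n%:R))%:R <= t * n%:R by rewrite truncn_le.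
exists (Num.truncn (t * n%:R)).
  by rewrite -(ler_nat R); apply: le_trans trunc_le _; rewrite ler_piMl// ltW.
rewrite ger0_norm; last by rewrite subr_ge0 ler_pdivrMr.
by rewrite lerBlDl -[X in _ <= _ + X]mul1r -mulrDl ler_pdivlMr// natr1 ltW// truncnS_gt.
Qed.

Lemma continuous01_le_grid (u : R -> R) (c : R) : continuous01 u ->
  (forall m j, (j <= m.+1)%N -> u (j%:R / m.+1%:R) <= c) ->
  forall t, 0 <= t <= 1 -> u t <= c.
Proof.
move=> /continuous01P cu u_le t t01; apply/ler_addgt0Pr => e e0.
have [r r0 ur] := cu _ t01 _ e0; have [m mr] := inv_succ_lt r0.
have [j jm tj] := grid_approx (ltn0Sn m) t01.
have j01 : 0 <= (j%:R / m.+1%:R : R) <= 1.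
  by rewrite divr_ge0//= ler_pdivrMr// mul1r ler_nat.
have := u_le _ _ jm; have : `|u t - u (j%:R / m.+1%:R)| < e.
  by apply: ur => //; exact: le_lt_trans tj mr.
by have := ler_norm (u t - u (j%:R / m.+1%:R)); lra.
Qed.

Section random_functions.
Context d (T : measurableType d).

Definition Cmeasurable (Z : T -> R[i]) :=
  measurable_fun setT (fun w => complex.Re (Z w)) /\
  measurable_fun setT (fun w => complex.Im (Z w)).

Lemma CmeasurableZ (c : R[i]) (X : T -> R) : measurable_fun setT X ->
  Cmeasurable (fun w => c * (X w)%:C).
Proof.
move=> mX; split.
  under eq_fun do rewrite ReM /= mulr0 subr0.
  exact: measurable_funM.
under eq_fun do rewrite ImM /= mulr0 add0r.
exact: measurable_funM.
Qed.

Lemma Cmeasurable_cst (c : R[i]) : Cmeasurable (fun=> c).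
Proof. by split; exact: measurable_cst. Qed.

Lemma CmeasurableD Z1 Z2 : Cmeasurable Z1 -> Cmeasurable Z2 ->
  Cmeasurable (fun w => Z1 w + Z2 w).
Proof.
move=> [Re1 Im1] [Re2 Im2]; split.
  by under eq_fun do rewrite ReD; exact: measurable_funD.
by under eq_fun do rewrite ImD; exact: measurable_funD.
Qed.

Lemma CmeasurableB Z1 Z2 : Cmeasurable Z1 -> Cmeasurable Z2 ->
  Cmeasurable (fun w => Z1 w - Z2 w).
Proof.
move=> [Re1 Im1] [Re2 Im2]; split.
  by under eq_fun do rewrite ReB; exact: measurable_funB.
by under eq_fun do rewrite ImB; exact: measurable_funB.
Qed.

Lemma Cmeasurable_sum (I : Type) (r : seq I) (Z : I -> T -> R[i]) :
  (forall i, Cmeasurable (Z i)) -> Cmeasurable (fun w => \sum_(i <- r) Z i w).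
Proof.
move=> mZ; elim: r => [|i r IH].
  by under eq_fun do rewrite big_nil; exact: Cmeasurable_cst.
by under eq_fun do rewrite big_cons; exact: CmeasurableD.
Qed.

Lemma measurable_normc Z : Cmeasurable Z -> measurable_fun setT (fun w => normc (Z w)).
Proof.
move=> [mRe mIm]; rewrite (_ : (fun w => _) =
    Num.sqrt \o (fun w => complex.Re (Z w) ^+ 2 + complex.Im (Z w) ^+ 2)); last first.
  by apply/funext => w /=; case: (Z w).
apply: (measurableT_comp (continuous_measurable_fun (@sqrt_continuous R))).
by apply: measurable_funD; exact: measurable_funX.
Qed.

Lemma measurable_forall01_le (u : T -> R -> R) (c : R) :
  (forall t, measurable_fun setT (u^~ t)) -> (forall w, continuous01 (u w)) ->
  measurable [set w | forall t, 0 <= t <= 1 -> u w t <= c].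
Proof.
move=> mu cu; rewrite (_ : [set w | _] =
  \bigcap_m \bigcap_(j in [set j | (j <= m.+1)%N]) [set w | u w (j%:R / m.+1%:R) <= c]).
  apply: bigcapT_measurable => m; apply: bigcap_measurable => [|j _]; first by exists 0%N.
  by rewrite -[X in measurable X]setTI; exact: measurable_fun_le.
apply/seteqP; split=> w /= u_le => [m _ j /= jm|].
  by apply: u_le; rewrite divr_ge0//= ler_pdivrMr// mul1r ler_nat.
by apply: continuous01_le_grid (cu w) _ => m j jm; exact: u_le.
Qed.

Lemma measurable_uniform_limit_sup_ball (F : nat -> T -> R -> R[i]) f (eps : R) :
  (forall N t, Cmeasurable ((F N)^~ t)) -> (forall N w, Ccontinuous01 (F N w)) ->
  Ccontinuous01 f ->
  measurable [set w | exists k, uniform_limit01 (fun N => F N w) k /\ sup_ball f eps k].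
Proof.
move=> mF cF cf; rewrite (_ : [set w | _] =
  (\bigcap_p \bigcup_N0 \bigcap_N \bigcap_M [set w | forall t, 0 <= t <= 1 ->
     normc (F (N0 + N)%N w t - F (N0 + M)%N w t) <= p.+1%:R^-1]) `&`
  (\bigcup_p \bigcup_N0 \bigcap_N [set w | forall t, 0 <= t <= 1 ->
     normc (F (N0 + N)%N w t - f t) <= eps - p.+1%:R^-1])).
  apply: measurableI.
    apply: bigcapT_measurable => p; apply: bigcupT_measurable => N0.
    do 2!apply: bigcapT_measurable => ?; apply: measurable_forall01_le => [t|w].
      exact/measurable_normc/CmeasurableB.
    exact: (continuous01_normc (continuous01B (cF _ w) (cF _ w))).
  do 2!apply: bigcupT_measurable => ?; apply: bigcapT_measurable => N.
  apply: measurable_forall01_le => [t|w].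
    exact/measurable_normc/CmeasurableB/Cmeasurable_cst.
  exact: (continuous01_normc (continuous01B (cF _ w) cf)).
apply/seteqP; split=> w /=.
  move=> /(uniform_limit_sup_ballP eps (cF^~ w) cf)[cauchy_F [p [N0 near_f]]]; split.
    move=> q _; have [N1 FN] := cauchy_F q; exists N1 => // N _ M _ /=.
    by apply: FN; exact: leq_addr.
  by exists p => //; exists N0 => // N _ /=; apply: near_f; exact: leq_addr.
move=> [cauchy_F [p _ [N0 _ near_f]]]; apply/(uniform_limit_sup_ballP eps (cF^~ w) cf); split.
  move=> q; have [N1 _ FN] := cauchy_F q Logic.I; exists N1 => N M N1N N1M.
  by have := FN (N - N1)%N Logic.I (M - N1)%N Logic.I; rewrite /= !subnKC.
by exists p, N0 => N N0N; have := near_f (N - N0)%N Logic.I; rewrite /= subnKC.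
Qed.

End random_functions.
End uniform_limits.

(** * Tails of the random series *)

Section symmetric_range.
Implicit Types (a c n : nat) (h : int).

Definition sym_range a c : seq int :=
  [seq Posz n | n <- index_iota a c] ++ [seq - Posz n | n <- index_iota a c].

Lemma mem_sym_range a c h : (h \in sym_range a c) = (a <= `|h| < c)%N.
Proof.
rewrite mem_cat -mem_index_iota; apply/orP/idP.
  by case=> /mapP[n + ->]; rewrite ?abszN.
by case: h => n hn; [left|right]; apply/mapP; [exists n|exists n.+1].
Qed.

Lemma sym_range_uniq a c : (0 < a)%N -> uniq (sym_range a c).
Proof.
move=> a0; rewrite cat_uniq !map_inj_uniq ?iota_uniq ?andbT/=; last 2 first.
- by move=> x y /oppr_inj [].
- by move=> x y [].
apply/hasPn => h /mapP[n]; rewrite mem_index_iota => /andP[an _] ->.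
by apply/negP => /mapP[k _]; lia.
Qed.

Lemma size_sym_range a c : size (sym_range a c) = (2 * (c - a))%N.
Proof. by rewrite size_cat !size_map size_iota mul2n addnn. Qed.

Lemma paired_sum_sym_range (R : realType) (x : int -> R) a c (t : R) :
  paired_sum x a c t = \sum_(h <- sym_range a c) integrated_character h t * (x h)%:C.
Proof. by rewrite /sym_range big_cat !big_map /paired_sum big_split. Qed.

End symmetric_range.

Section good_blocks.
Context (R : realType).
Implicit Types (x : int -> R) (t s : R) (m n M N : nat).

Definition block_start m : nat := ((2 ^ m) ^ 4)%N.

(* A block has [O(16^m)] terms, each of them [O(1)]-Lipschitz, so that a bound along
   the grid of step [32^-m] holds up to [O(2^-m)] on the whole interval. *)
Definition good_block x m := forall N j, (N <= block_start m.+1)%N -> (j <= (2 ^ m) ^ 5)%N ->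
  normc (paired_sum x (block_start m) N (j%:R / ((2 ^ m) ^ 5)%:R)) <= 2 / (2 ^ m)%:R.

Lemma block_start_gt0 m : (0 < block_start m)%N.
Proof. by rewrite !expn_gt0. Qed.

Lemma block_startS m : block_start m.+1 = (16 * block_start m)%N.
Proof. by rewrite /block_start (expnS 2 m) expnMn. Qed.

Lemma leq_block_start m M : (m <= M)%N -> (block_start m <= block_start M)%N.
Proof. by move=> mM; rewrite leq_exp2r// leq_exp2l. Qed.

Lemma ltn_block_start m : (m < block_start m)%N.
Proof.
apply: leq_trans (ltn_expl m (isT : 1 < 2)%N) _.
by rewrite -[leqLHS]expn1 leq_pexp2l// expn_gt0.
Qed.

Lemma paired_sum_cat x M n N t : (M <= n)%N -> (n <= N)%N ->
  paired_sum x M N t = paired_sum x M n t + paired_sum x n N t.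
Proof. by move=> Mn nN; rewrite /paired_sum -big_cat_nat. Qed.

Lemma paired_sum_lipschitz x (B : R) M N t s :
  (forall h, (M <= `|h| < N)%N -> `|x h| <= B) ->
  normc (paired_sum x M N t - paired_sum x M N s) <= 2 * B * (N - M)%:R * `|t - s|.
Proof.
move=> xB; rewrite !paired_sum_sym_range -sumrB; apply: le_trans (ler_normc_sum _ _ _) _.
apply: (@le_trans _ _ (\sum_(h <- sym_range M N) B * `|t - s|)).
  rewrite big_seq [leRHS]big_seq; apply: ler_sum => h; rewrite mem_sym_range => /xB xhB.
  by rewrite -mulrBl normcM normcR mulrC ler_pM ?normc_ge0// integrated_character_lipschitz.
rewrite big_const_seq count_predT iter_addr_0 size_sym_range -[_ *+ _]mulr_natl natrM.
by rewrite le_eqVlt; apply/orP; left; apply/eqP; ring.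
Qed.

Lemma good_block_le x m N t : (forall h, `|x h| <= 2) -> good_block x m ->
  (N <= block_start m.+1)%N -> 0 <= t <= 1 ->
  normc (paired_sum x (block_start m) N t) <= 66 / (2 ^ m)%:R.
Proof.
move=> x2 good Nm t01; have q0 : (0 < (2 ^ m) ^ 5)%N by rewrite !expn_gt0.
have [j jm tj] := grid_approx q0 t01.
have {}good := good N j Nm jm.
have lip := paired_sum_lipschitz t (j%:R / ((2 ^ m) ^ 5)%:R)
  (fun h (_ : (block_start m <= `|h| < N)%N) => x2 h).
have size_block : (N - block_start m)%:R <= 16 * (2 ^ m)%:R ^+ 4 :> R.
  by rewrite -natrX -natrM ler_nat -block_startS; apply: leq_trans (leq_subr _ _) Nm.
have {}lip : normc (paired_sum x (block_start m) N t -
    paired_sum x (block_start m) N (j%:R / ((2 ^ m) ^ 5)%:R)) <= 64 / (2 ^ m)%:R.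
  apply: le_trans lip _; have q1 : 0 < (2 ^ m)%:R :> R by rewrite ltr0n expn_gt0.
  apply: (@le_trans _ _ (2 * 2 * (16 * (2 ^ m)%:R ^+ 4) * ((2 ^ m) ^ 5)%:R^-1)).
    by apply: ler_pM => //; apply: ler_wpM2l.
  rewrite (natrX _ (2 ^ m)); move: (2 ^ m)%:R q1 => q q1.
  by rewrite le_eqVlt; apply/orP; left; apply/eqP; field; rewrite gt_eqF.
have := ler_distcD (paired_sum x (block_start m) N (j%:R / ((2 ^ m) ^ 5)%:R))
  (paired_sum x (block_start m) N t) 0.
by rewrite !subr0; move: (2 ^ m)%:R^-1 lip good => q; lra.
Qed.

Lemma good_tail_le x m0 t : (forall h, `|x h| <= 2) ->
  (forall m, (m0 <= m)%N -> good_block x m) -> 0 <= t <= 1 ->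
  forall m N, (m0 <= m)%N -> (block_start m <= N)%N ->
  normc (paired_sum x (block_start m) N t) <= 132 / (2 ^ m)%:R.
Proof.
move=> x2 good t01.
suff by_depth j : forall m N, (m0 <= m)%N -> (block_start m <= N <= block_start (m + j))%N ->
    normc (paired_sum x (block_start m) N t) <= 132 / (2 ^ m)%:R.
  move=> m N m0m mN; apply: (by_depth N) => //; rewrite mN/=.
  apply: leq_trans (ltnW (ltn_block_start N)) _.
  by rewrite leq_block_start// leq_addl.
have q0 m : 0 < (2 ^ m)%:R^-1 :> R by rewrite invr_gt0 ltr0n expn_gt0.
elim: j => [|j IH] m N m0m /andP[mN Nm].
  rewrite addn0 in Nm; rewrite /paired_sum big_geq// normc0.
  by rewrite mulr_ge0// ltW.
have [Nm1|/ltnW Nm1] := leqP N (block_start m.+1).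
  apply: le_trans (good_block_le x2 (good _ m0m) Nm1 t01) _.
  by rewrite ler_pM2r//; lra.
rewrite (paired_sum_cat _ _ (leq_block_start (leqnSn m)) Nm1).
apply: le_trans (le_normcD _ _) _.
have block := good_block_le x2 (good _ m0m) (leqnn _) t01.
have rest : normc (paired_sum x (block_start m.+1) N t) <= 132 / (2 ^ m.+1)%:R.
  by apply: IH; rewrite ?leqW// Nm1 addSnnS.
move: block rest; rewrite expnS natrM invfM; move: (2 ^ m)%:R^-1 => q; lra.
Qed.

End good_blocks.

Section complex_chernoff.
Context d (T : measurableType d) (R : realType) (I : eqType).
Variables (P : probability T R) (X : I -> T -> R) (C : R).
Hypothesis mX : forall i, measurable_fun setT (X i).
Hypothesis laplaceX : forall i s,
  (\int[P]_w (expR (s * X i w))%:E <= (expR (C * s ^+ 2))%:E)%E.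
Hypothesis C0 : 0 <= C.

Lemma measurable_normc_sum (J : seq I) (z : I -> R[i]) :
  measurable_fun setT (fun w => normc (\sum_(j <- J) z j * (X j w)%:C)).
Proof. by apply/measurable_normc/Cmeasurable_sum => j; exact: CmeasurableZ. Qed.

Lemma chernoff_normc_independent (mu : {measure set T -> \bar R}) (J : seq I)
    (z : I -> R[i]) (s l : R) :
  mu setT \is a fin_num -> uniq J -> independent_under P X mu J -> 0 <= s ->
  (mu [set w | (2 * l <= normc (\sum_(j <- J) z j * (X j w)%:C))%R] <=
   mu setT * (4 * expR (C * s ^+ 2 * (\sum_(j <- J) normc (z j) ^+ 2) - s * l))%:E)%E.
Proof.
move=> mu_fin uJ indep s0.
pose far (p : R[i] -> R) := [set w | l <= `|\sum_(j <- J) p (z j) * X j w|].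
have mfar p : measurable (far p).
  rewrite -[X in measurable X]setTI; apply: measurable_fun_le => //.
  by apply: measurableT_comp => //; apply: measurable_sum => j; exact: measurable_funM.
have far_prob p : (forall c : R[i], `|p c| <= normc c) ->
    (mu (far p) <= mu setT *
      (2 * expR (C * s ^+ 2 * (\sum_(j <- J) normc (z j) ^+ 2) - s * l))%:E)%E.
  move=> p_le; apply: le_trans (chernoff_norm_independent mX laplaceX _ _ mu_fin uJ indep s0) _.
  apply: lee_wpmul2l; first exact: measure_ge0.
  rewrite lee_fin ler_pM2l// ler_expR lerB// ler_wpM2l ?mulr_ge0 ?sqr_ge0//.
  apply: ler_sum => j _; rewrite -[leLHS]real_normK ?num_real//.
  by rewrite lerXn2r ?nnegrE ?normc_ge0.
apply: (@le_trans _ _ (mu (far (@complex.Re R) `|` far (@complex.Im R)))).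
  apply: le_measure; rewrite ?inE.
  - rewrite -[X in measurable X]setTI.
    by apply: measurable_fun_le => //; exact: measurable_normc_sum.
  - exact: measurableU.
  move=> w /= big_sum; apply/orP; rewrite -implyNb -ltNge; apply/implyP => Re_lt.
  have := normc_le_ReIm (\sum_(j <- J) z j * (X j w)%:C).
  have -> : complex.Re (\sum_(j <- J) z j * (X j w)%:C) = \sum_(j <- J) complex.Re (z j) * X j w.
    rewrite (big_morph _ (@ReD R) (erefl _)).
    by apply: eq_bigr => j _; rewrite ReM /= mulr0 subr0.
  have -> : complex.Im (\sum_(j <- J) z j * (X j w)%:C) = \sum_(j <- J) complex.Im (z j) * X j w.
    rewrite (big_morph _ (@ImD R) (erefl _)).
    by apply: eq_bigr => j _; rewrite ImM /= mulr0 add0r.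
  by move: Re_lt big_sum; lra.
apply: le_trans (measureU2 _ (mfar _) (mfar _)) _.
have -> : 4 = 2 + 2 :> R by ring.
rewrite mulrDl EFinD muleDr ?ge0_adde_def ?inE ?lee_fin ?mulr_ge0 ?expR_ge0//.
by apply: leeD; apply: far_prob; [exact: Re_le_normc|exact: Im_le_normc].
Qed.

End complex_chernoff.

Section bad_blocks.
Context d (T : measurableType d) (R : realType) (P : probability T R) (X : int -> T -> R).
Hypothesis mX : forall h, measurable_fun setT (X h).
Implicit Types (m n N M j : nat) (t : R).

Definition bad_block m : set T :=
  \big[setU/set0]_(N < (block_start m.+1).+1) \big[setU/set0]_(j < ((2 ^ m) ^ 5).+1)
    [set w | 2 / (2 ^ m)%:R <=
       normc (paired_sum (X^~ w) (block_start m) N (j%:R / ((2 ^ m) ^ 5)%:R))].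

Definition bad_tail m0 : set T := \bigcup_i bad_block (m0 + i).

Lemma not_bad_block_good m w : ~ bad_block m w -> good_block (X^~ w) m.
Proof.
move=> not_bad N j Nm jm; rewrite leNgt; apply/negP => big_sum; apply: not_bad.
rewrite /bad_block (bigD1 (inord N))//=; left.
by rewrite (bigD1 (inord j))//=; left; rewrite /= !inordK ?ltnS// ltW.
Qed.

Lemma not_bad_tail_good m0 w : ~ bad_tail m0 w -> forall m, (m0 <= m)%N -> good_block (X^~ w) m.
Proof.
move=> not_bad m m0m; apply: not_bad_block_good => bad; apply: not_bad.
by exists (m - m0)%N => //; rewrite subnKC.
Qed.

Lemma measurable_normc_paired_sum_ge M N t (l : R) :
  measurable [set w | l <= normc (paired_sum (X^~ w) M N t)].
Proof.
rewrite -[X in measurable X]setTI; apply: measurable_fun_le => //.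
under eq_fun do rewrite paired_sum_sym_range.
exact: measurable_normc_sum.
Qed.

Lemma measurable_bad_block m : measurable (bad_block m).
Proof.
by do 2!apply: bigsetU_measurable => ? _; exact: measurable_normc_paired_sum_ge.
Qed.

Lemma measurable_bad_tail m0 : measurable (bad_tail m0).
Proof. by apply: bigcupT_measurable => i; exact: measurable_bad_block. Qed.

Hypothesis lawX : forall h, sato_tate_law P (X h).
Variable mu : {measure set T -> \bar R}.
Hypothesis mu_fin : mu setT \is a fin_num.

(* The exponent is chosen as [s = 4^m]: then [s / 2^m = 2^m], while the block has at
   most [32 * 16^m] coefficients of modulus at most [16^-m]. *)
Lemma measure_block_deviation_le m N t : (N <= block_start m.+1)%N ->
  independent_under P X mu (sym_range (block_start m) N) ->
  (mu [set w | (2 / (2 ^ m)%:R <= normc (paired_sum (X^~ w) (block_start m) N t))%R] <=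
   mu setT * (4 * expR (256 - (2 ^ m)%:R))%:E)%E.
Proof.
move=> Nm indep; set J := sym_range _ _ in indep *; set q : R := (2 ^ m)%:R.
have q0 : 0 < q by rewrite ltr0n expn_gt0.
have uJ : uniq J by exact/sym_range_uniq/block_start_gt0.
pose z h := integrated_character h t.
have z_le h : h \in J -> normc (z h) ^+ 2 <= q ^- 8.
  rewrite mem_sym_range => /andP[mh _].
  have h0 : h != 0 by apply: contraTneq mh => ->; rewrite leqNgt block_start_gt0.
  rewrite -[8%N]/(4 * 2)%N exprM -exprVn.
  rewrite lerXn2r ?nnegrE ?normc_ge0 ?invr_ge0 ?exprn_ge0 ?(ltW q0)//.
  apply: le_trans (integrated_character_le t h0) _.
  rewrite lef_pV2 ?posrE ?exprn_gt0 ?ltr0z ?normr_gt0// -natrX.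
  by rewrite -[`|h|%R]/(Posz `|h|%N) ler_nat.
have sum_z : \sum_(h <- J) normc (z h) ^+ 2 <= 32 / q ^+ 4.
  apply: (@le_trans _ _ (\sum_(h <- J) q ^- 8)).
    by rewrite big_seq [leRHS]big_seq; apply: ler_sum => h; exact: z_le.
  rewrite big_const_seq count_predT iter_addr_0 size_sym_range -[_ *+ _]mulr_natl.
  apply: (@le_trans _ _ (32 * q ^+ 4 * q ^- 8)).
    rewrite ler_wpM2r ?invr_ge0 ?exprn_ge0 ?(ltW q0)// -natrX -natrM ler_nat.
    have : (N - block_start m <= 16 * (2 ^ m) ^ 4)%N.
      by rewrite -block_startS; exact: leq_trans (leq_subr _ _) Nm.
    by lia.
  by rewrite le_eqVlt; apply/orP; left; apply/eqP; field; rewrite gt_eqF.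
have laplaceX h s := sato_tate_laplace (mX h) (@lawX h) s.
have := chernoff_normc_independent mX laplaceX (ler0n R 8) z q^-1 mu_fin uJ indep (sqr_ge0 q).
under [X in _ -> (mu X <= _)%E]eq_set do rewrite paired_sum_sym_range.
move=> /le_trans; apply; apply: lee_wpmul2l; first exact: measure_ge0.
rewrite lee_fin ler_pM2l// ler_expR expr2 mulfK ?gt_eqF//.
rewrite lerB//; apply: (@le_trans _ _ (8 * (q * q) ^+ 2 * (32 / q ^+ 4))).
  by rewrite ler_wpM2l// mulr_ge0// sqr_ge0.
by rewrite le_eqVlt; apply/orP; left; apply/eqP; field; rewrite gt_eqF.
Qed.

(* [bad_block m] is a union of at most [34 * q^9] events of measure at most
   [4 * exp (256 - q)], where [q = 2^m] and [q^10 <= 10^10 * exp q]. *)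
Definition tail_constant : R := 136 * expR 256 * 10 ^+ 10.

Lemma tail_constant_ge0 : 0 <= tail_constant.
Proof. exact: mulr_ge0 (mulr_ge0 (ler0n _ 136) (expR_ge0 _)) (exprn_ge0 10 (ler0n _ 10)). Qed.

Lemma expr10_le_expR (q : R) : 0 <= q -> q ^+ 10 <= 10 ^+ 10 * expR q.
Proof.
move=> q0; have -> : expR q = expR (q / 10) ^+ 10.
  by rewrite -expRM_natl; congr expR; lra.
rewrite -exprMn lerXn2r ?nnegrE ?mulr_ge0 ?expR_ge0//.
have := expR_ge1Dx (q / 10); lra.
Qed.

Lemma block_union_bound_le (q : R) : 1 <= q ->
  (16 * q ^+ 4 + 1) * ((q ^+ 5 + 1) * (4 * expR (256 - q))) <= tail_constant / q.
Proof.
move=> q1; have q0 : 0 < q by exact: lt_le_trans q1.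
have q4 : 1 <= q ^+ 4 by rewrite exprn_ege1.
have q5 : 1 <= q ^+ 5 by rewrite exprn_ege1.
have -> : tail_constant / q =
    (17 * q ^+ 4) * ((2 * q ^+ 5) * (4 * (expR 256 * (10 ^+ 10 / q ^+ 10)))).
  by rewrite /tail_constant; move: (expR 256) => E; field; rewrite gt_eqF.
have exp_le : expR (256 - q) <= expR 256 * (10 ^+ 10 / q ^+ 10).
  rewrite expRD expRN ler_wpM2l ?expR_ge0// ler_pdivlMr ?exprn_gt0//.
  by rewrite mulrC ler_pdivrMr ?expR_gt0// expr10_le_expR// ltW.
have e0 := expR_ge0 (256 - q).
apply: ler_pM; [lra| |lra|]; first by rewrite !mulr_ge0//; lra.
by apply: ler_pM; [lra| |lra|]; rewrite ?mulr_ge0// ler_wpM2l.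
Qed.

Lemma bigsetU_measure_le (A : nat -> set T) (c : \bar R) n :
  (forall i, measurable (A i)) -> (forall i, (i < n)%N -> (mu (A i) <= c)%E) ->
  (mu (\big[setU/set0]_(i < n) A i) <= n%:R%:E * c)%E.
Proof.
move=> mA Ac; apply: le_trans (Boole_inequality mu (fun i _ => mA i)) _.
apply: (@le_trans _ _ (\sum_(i < n) c)%E); first by apply: lee_sum => i _; exact: Ac.
by rewrite sumr_const card_ord mule_natl.
Qed.

Variable m0 : nat.
Hypothesis indep : forall J, uniq J -> (forall h, h \in J -> (block_start m0 <= `|h|)%N) ->
  independent_under P X mu J.

Lemma measure_bad_block_le m : (m0 <= m)%N ->
  (mu (bad_block m) <= mu setT * (tail_constant / (2 ^ m)%:R)%:E)%E.
Proof.
move=> m0m; set c := (mu setT * (4 * expR (256 - (2 ^ m)%:R))%:E)%E.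
have point_le N t : (N <= block_start m.+1)%N ->
    (mu [set w | (2 / (2 ^ m)%:R <= normc (paired_sum (X^~ w) (block_start m) N t))%R] <= c)%E.
  move=> Nm; apply: measure_block_deviation_le => //; apply: indep => [|h].
    exact/sym_range_uniq/block_start_gt0.
  by rewrite mem_sym_range => /andP[+ _]; apply: leq_trans; exact: leq_block_start.
have q1 : 1 <= (2 ^ m)%:R :> R by rewrite ler1n expn_gt0.
pose deviation N j := [set w | 2 / (2 ^ m)%:R <=
  normc (paired_sum (X^~ w) (block_start m) N (j%:R / ((2 ^ m) ^ 5)%:R))].
have mdev N j : measurable (deviation N j) by exact: measurable_normc_paired_sum_ge.
pose bad_grid N := \big[setU/set0]_(j < ((2 ^ m) ^ 5).+1) deviation N j.
have mgrid N : measurable (bad_grid N) by exact: bigsetU_measurable.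
apply: (@le_trans _ _ ((block_start m.+1).+1%:R%:E * (((2 ^ m) ^ 5).+1%:R%:E * c))%E).
  apply: (@bigsetU_measure_le bad_grid) => // N Nm.
  by apply: (@bigsetU_measure_le (deviation N)) => // j _; exact: point_le.
rewrite /c (muleCA _%:E (mu _)) (muleCA _%:E (mu _)) -!EFinM; apply: lee_wpmul2l => //.
have -> : (block_start m.+1).+1%:R = 16 * (2 ^ m)%:R ^+ 4 + 1 :> R.
  by rewrite -natr1 block_startS natrM /block_start (natrX _ (2 ^ m)).
have -> : ((2 ^ m) ^ 5).+1%:R = (2 ^ m)%:R ^+ 5 + 1 :> R by rewrite -natr1 (natrX _ (2 ^ m)).
by rewrite lee_fin; exact: block_union_bound_le.
Qed.

Lemma measure_bad_tail_le : 4 * tail_constant <= (2 ^ m0)%:R ->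
  (mu (bad_tail m0) <= mu setT * (2^-1)%:E)%E.
Proof.
move=> m0_large; have q0 : 0 < (2 ^ m0)%:R :> R by rewrite ltr0n expn_gt0.
pose p := fine (mu setT); have muE : mu setT = p%:E by rewrite fineK.
have p0 : 0 <= p by rewrite fine_ge0.
have C0 := tail_constant_ge0; pose e := p * (2 * tail_constant / (2 ^ m0)%:R).
have e0 : 0 <= e.
  apply: mulr_ge0 => //; apply: divr_ge0; last exact: ltW.
  exact: mulr_ge0 (ler0n _ 2) C0.
have := measure_sigma_subadditive mu (fun i => measurable_bad_block (m0 + i))
  (measurable_bad_tail m0) (@subset_refl _ _).
move=> /le_trans; apply; apply: (@le_trans _ _ e%:E); last first.
  by rewrite muE -EFinM lee_fin ler_wpM2l// ler_pdivrMr//; lra.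
apply: le_trans (epsilon_trick0 xpredT e0); apply: lee_nneseries => [//|i _].
apply: le_trans (measure_bad_block_le (leq_addr _ _)) _.
rewrite muE -EFinM lee_fin /e expnD expnS !natrM le_eqVlt; apply/orP; left; apply/eqP.
have : (2 ^ i)%:R != 0 :> R by rewrite pnatr_eq0 expn_eq0.
by move: (2 ^ i)%:R (2 ^ m0)%:R q0 => a q q0 a0; field; rewrite a0 gt_eqF.
Qed.

End bad_blocks.

(** * The support *)

Section path_estimates.
Context (R : realType).
Implicit Types (x y : int -> R) (t e : R) (L m N p : nat).

Lemma trig_pathB x n N t : (n <= N)%N ->
  trig_path x N t - trig_path x n t = paired_sum x n.+1 N.+1 t.
Proof.
by move=> nN; rewrite /trig_path (paired_sum_cat x t (ltn0Sn n) (nN : n.+1 <= N.+1)%N); ring.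
Qed.

Lemma trig_path_truncate y L N : (L <= N)%N ->
  trig_path (fun h => if (`|h| <= L)%N then y h else 0) N = trig_path y L.
Proof.
move=> LN; apply/funext => t; rewrite /trig_path; congr (_ + _).
rewrite (paired_sum_cat _ t (ltn0Sn L) (LN : L.+1 <= N.+1)%N) [X in _ + X]big_nat_cond big1.
  by rewrite addr0; apply: eq_big_nat => n /andP[_]; rewrite abszN ltnS => /= ->.
by move=> n /andP[/andP[Ln _] _]; rewrite abszN leqNgt Ln !mulr0 addr0.
Qed.

Lemma trig_path_dist x y e N t : (forall h, (`|h| <= N)%N -> `|x h - y h| <= e) ->
  0 <= t <= 1 -> normc (trig_path x N t - trig_path y N t) <= e * (1 + 2 * N%:R).
Proof.
move=> xy /andP[t0 t1]; have e0 : 0 <= e by apply: le_trans (xy 0 _).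
have -> : trig_path x N t - trig_path y N t =
    (t * (x 0 - y 0))%:C + paired_sum (fun h => x h - y h) 1 N.+1 t.
  rewrite /trig_path !paired_sum_sym_range.
  under [in RHS]eq_bigr do rewrite rmorphB mulrBr.
  by rewrite sumrB mulrBr rmorphB; ring.
apply: le_trans (le_normcD _ _) _; rewrite [leRHS]mulrDr mulr1; apply: lerD.
  by rewrite normcR normrM ger0_norm//; apply: le_trans (xy 0 _); rewrite ?ler_piMl.
have := paired_sum_lipschitz t 0 (fun h (h_range : (1 <= `|h| < N.+1)%N) =>
  xy h (proj2 (andP h_range))).
rewrite [X in normc (_ - X)]big1 => [|n _]; last by rewrite !integrated_character0 !mul0r addr0.
rewrite !subr0 subn1 (ger0_norm t0) => /le_trans; apply.
by rewrite (mulrC 2) -!mulrA ler_wpM2l// ler_wpM2l// ler_piMr.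
Qed.

Lemma exists_pow2_ge (c : R) L : exists2 m, (L <= m)%N & c <= (2 ^ m)%:R.
Proof.
exists (maxn L (Num.truncn c).+1); first exact: leq_maxl.
apply: le_trans (ltW (truncnS_gt c)) _; rewrite ler_nat.
by apply: leq_trans (leq_maxr L _) _; exact: ltnW (ltn_expl _ _).
Qed.

Lemma trig_path_tail x m0 m N t : (forall h, `|x h| <= 2) ->
  (forall m, (m0 <= m)%N -> good_block x m) -> 0 <= t <= 1 ->
  (m0 <= m)%N -> (block_start m <= N)%N ->
  normc (trig_path x N t - trig_path x (block_start m).-1 t) <= 132 / (2 ^ m)%:R.
Proof.
move=> x2 good t01 m0m mN; rewrite trig_pathB; last exact: leq_trans (leq_pred _) mN.
rewrite prednK ?block_start_gt0//.
by apply: good_tail_le good _ _ _ _ _ => //; rewrite leqW.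
Qed.

Lemma trig_path_cauchy x m0 : (forall h, `|x h| <= 2) ->
  (forall m, (m0 <= m)%N -> good_block x m) -> uniform_cauchy01 (trig_path x).
Proof.
move=> x2 good p; have [m m0m m_large] := exists_pow2_ge (264 * p.+1%:R) m0.
have q0 : 0 < (2 ^ m)%:R :> R by rewrite ltr0n expn_gt0.
have small : 264 / (2 ^ m)%:R <= p.+1%:R^-1 :> R.
  by rewrite ler_pdivrMr// mulrC ler_pdivlMr.
exists (block_start m) => N M mN mM t t01.
apply: le_trans (ler_distcD (trig_path x (block_start m).-1 t) _ _) _.
rewrite (normcC (trig_path x _.-1 t)).
have := trig_path_tail x2 good t01 m0m mN; have := trig_path_tail x2 good t01 m0m mM.
by move: small; move: (2 ^ m)%:R^-1 (p.+1%:R^-1) => q r; lra.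
Qed.

End path_estimates.

Lemma ae_subset_measure_gt0 d (T : measurableType d) (R : realType)
    (mu : {measure set T -> \bar R}) (G E : set T) : measurable G -> measurable E ->
  (0 < mu G)%E -> {ae mu, forall w, G w -> E w} -> (0 < mu E)%E.
Proof.
move=> mG mE G0 [N [mN N0 subN]]; apply: lt_le_trans G0 _.
apply: (@le_trans _ _ (mu (E `|` N))).
  apply: le_measure; rewrite ?inE//; first exact: measurableU.
  move=> w Gw; have [Ew|nEw] := pselect (E w); first by left.
  by right; apply: subN => /= GE; exact/nEw/GE.
by apply: le_trans (measureU2 _ mE mN) _; rewrite [X in (_ + X)%E]N0 adde0.
Qed.

Section random_series.
Context d (T : measurableType d) (R : realType) (P : probability T R) (ST : int -> T -> R).
Hypothesis ST_meas : forall h, measurable_fun setT (ST h).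
Hypothesis ST_indep : mutually_independent P ST.
Hypothesis ST_law : forall h, sato_tate_law P (ST h).
Implicit Types (f : R -> R[i]) (y : int -> R) (B : int -> set R) (e : R) (m N L : nat).

Lemma sato_tate_family_ae_bounded : {ae P, forall w, forall h, `|ST h w| <= 2}.
Proof.
have ae_bounded h : {ae P, forall w, `|ST h w| <= 2} by exact: sato_tate_ae_bounded.
have Pos := ae_foralln (fun n => ae_bounded (Posz n)).
have Neg := ae_foralln (fun n => ae_bounded (Negz n)).
by apply: filterS2 Pos Neg => w Pos Neg [].
Qed.

Lemma independent_under_mrestr H B J (mA : measurable (cylinder ST H B)) :
  (forall h, measurable (B h)) -> uniq (J ++ H) ->
  independent_under P ST (mrestr P mA) J.
Proof.
move=> mB uJH B' mB'; have := uJH; rewrite cat_uniq => /and3P[uJ /hasPn JH uH].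
pose BB h := if h \in H then B h else B' h.
have mBB h : measurable (BB h) by rewrite /BB; case: ifP.
have BBJ h : h \in J -> BB h = B' h.
  by move=> hJ; rewrite /BB ifN//; apply: contraTN hJ => /JH.
have BBH h : h \in H -> BB h = B h by rewrite /BB => ->.
transitivity (P (cylinder ST (J ++ H) BB)).
  rewrite [LHS]/= /mrestr /cylinder big_cat; congr (P (_ `&` _)).
    by apply: eq_big_seq => h /BBJ ->.
  by apply: eq_big_seq => h /BBH ->.
have totalA : mrestr P mA setT = P (cylinder ST H B) by rewrite /mrestr setTI.
rewrite [LHS]ST_indep// big_cat [LHS]muleC.
rewrite [X in _ = (X * _)%E]totalA [X in _ = (X * _)%E]ST_indep//.
by congr (_ * _)%E; apply: eq_big_seq => h; [move=> /BBH ->|move=> /BBJ ->].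
Qed.

Lemma prescribed_head_good_tail m0 y e : 4 * tail_constant R <= (2 ^ m0)%:R ->
  (forall h, `|y h| <= 2) -> 0 < e ->
  exists G : set T, [/\ measurable G, (0 < P G)%E & forall w, G w ->
    (forall h, (`|h| < block_start m0)%N -> `|ST h w - y h| <= e) /\
    (forall m, (m0 <= m)%N -> good_block (ST^~ w) m)].
Proof.
move=> m0_large y2 e0; pose H := 0 :: sym_range 1 (block_start m0).
have memH h : (h \in H) = (`|h| < block_start m0)%N.
  rewrite inE mem_sym_range absz_gt0; have [->|//] := eqVneq h 0.
  by rewrite absz0 block_start_gt0.
have uH : uniq H by rewrite /= sym_range_uniq// mem_sym_range.
pose B h := [set` `](y h - e)%R, (y h + e)%R[].
have mB h : measurable (B h) by exact: measurable_itv.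
pose A := cylinder ST H B; have mA : measurable A by exact: measurable_cylinder.
have A0 : (0 < P A)%E.
  rewrite [P A]ST_indep//; apply: (big_ind (fun p => (0 < p)%E)) => //.
    by move=> p q; exact: mule_gt0.
  by move=> h _; apply: sato_tate_ball_gt0; rewrite -?ler_norml.
have PA_fin : P A \is a fin_num by exact: fin_num_measure.
pose p := fine (P A); have PAE : P A = p%:E by rewrite /p fineK.
have p0 : 0 < p by rewrite -lte_fin -PAE.
have totalA : mrestr P mA setT = P A by rewrite /mrestr setTI.
have tail_le : (P (bad_tail ST m0 `&` A) <= P A * (2^-1)%:E)%E.
  rewrite -[X in (_ <= X * _)%E]totalA -[leLHS]/(mrestr P mA _).
  apply: measure_bad_tail_le => //; first by rewrite [X in X \is a _]totalA.
  move=> J uJ J_large; apply: independent_under_mrestr => //.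
  rewrite cat_uniq uJ uH andbT; apply/hasPn => h; rewrite memH => h_small.
  by apply/negP => /J_large; rewrite leqNgt h_small.
exists (A `\` bad_tail ST m0); split.
- by apply: measurableD => //; exact: measurable_bad_tail.
- rewrite measureD//; [|exact: measurable_bad_tail|by rewrite ltey_eq PA_fin].
  rewrite sube_gt0// setIC; apply: le_lt_trans tail_le _.
  rewrite [X in (X * _ < _)%E]PAE [X in (_ < X)%E]PAE -EFinM lte_fin.
  by lra.
move=> w [Aw tail_w]; split; last exact: not_bad_tail_good.
move=> h; rewrite -memH => hH; move: Aw; rewrite /A /cylinder -bigcap_seq => /(_ h hH).
by rewrite /B /= in_itv/= -ltr_distl => /ltW.
Qed.

Lemma K_unif_limitP w k : K_unif_limit ST w k <-> uniform_limit01 (trig_path (ST^~ w)) k.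
Proof.
split=> Kk e /Kk[N0 KN]; exists N0 => N /KN Kt t.
  by move=> t01; rewrite -ltcR -normr_normc -K_partialE; apply: Kt; rewrite in_itv.
by rewrite in_itv normr_normc ltcR; exact: Kt.
Qed.

Lemma Cmeasurable_trig_path N t : Cmeasurable (fun w => trig_path (ST^~ w) N t).
Proof.
apply: CmeasurableD; first by under eq_fun do rewrite rmorphM; exact: CmeasurableZ.
under eq_fun do rewrite paired_sum_sym_range.
by apply: Cmeasurable_sum => h; exact: CmeasurableZ.
Qed.

Lemma measurable_support_event f e : Ccontinuous01 f ->
  measurable [set w | exists k, K_unif_limit ST w k /\ sup_ball f e k].
Proof.
move=> cf; rewrite (_ : [set w | _] =
    [set w | exists k, uniform_limit01 (trig_path (ST^~ w)) k /\ sup_ball f e k]).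
  apply: (measurable_uniform_limit_sup_ball (F := fun N w => trig_path (ST^~ w) N)).
  - exact: Cmeasurable_trig_path.
  - by move=> N w; exact: continuous01_trig_path.
  - exact: cf.
by apply/seteqP; split=> w [k [/K_unif_limitP Kk fk]]; exists k.
Qed.

Lemma support_approximable f : Ccontinuous01 f -> in_support_K P ST f -> approximable f.
Proof.
move=> cf supp e e0; have e20 : 0 < e / 2 by rewrite divr_gt0.
have mE := measurable_support_event (e / 2) cf.
apply: contrapT => not_approx.
suff : (0 < P set0)%E by rewrite measure0 ltxx.
apply: (ae_subset_measure_gt0 mE measurable0 (supp _ e20)).
apply: filterS sato_tate_family_ae_bounded => w ST2 [k [/K_unif_limitP Kk fk]].
have [N KN] := Kk _ e20; apply: not_approx; exists N, (ST^~ w); split=> // t t01.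
have := fk t; rewrite in_itv normr_normc ltcR => /(_ t01).
have := KN _ (leqnn N) t t01; have := ler_distcD (k t) (f t) (trig_path (ST^~ w) N t).
by rewrite (normcC (f t) (k t)) (normcC (k t) (trig_path _ _ _)); lra.
Qed.

Lemma approximable_support f : Ccontinuous01 f -> approximable f -> in_support_K P ST f.
Proof.
move=> cf approx eps eps0; pose e := eps / 4; have e0 : 0 < e by rewrite divr_gt0.
have [L [y' [y'2 fy']]] := approx _ e0.
pose y h := if (`|h| <= L)%N then y' h else 0.
have y2 h : `|y h| <= 2 by rewrite /y; case: ifP; rewrite ?normr0.
have [m0 Lm0 m0_large] := exists_pow2_ge (Num.max (4 * tail_constant R) (132 / e)) L.
move: m0_large; rewrite ge_max => /andP[m0_prob m0_tail].
pose M := (block_start m0).-1; have MS : M.+1 = block_start m0 by rewrite prednK ?block_start_gt0.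
have LM : (L <= M)%N by rewrite -ltnS MS (leq_ltn_trans Lm0)// ltn_block_start.
have M0 : 0 < 1 + 2 * M%:R :> R by rewrite ltr_wpDr.
have [G [mG G0 Ggood]] := prescribed_head_good_tail m0_prob y2 (divr_gt0 e0 M0).
apply: (ae_subset_measure_gt0 mG (measurable_support_event eps cf) G0).
apply: filterS sato_tate_family_ae_bounded => w ST2 /Ggood[head tail].
suff [k [Fk fk]] : exists k, uniform_limit01 (trig_path (ST^~ w)) k /\ sup_ball f eps k.
  by exists k; split=> //; exact/K_unif_limitP.
apply/(uniform_limit_sup_ballP eps (@continuous01_trig_path R (ST^~ w)) cf).
split; first exact: trig_path_cauchy ST2 tail.
have [p pe] := inv_succ_lt e0; exists p, (block_start m0) => N mN t t01.
have tail_close := trig_path_tail ST2 tail t01 (leqnn m0) mN; rewrite -/M in tail_close.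
have head_close : normc (trig_path (ST^~ w) M t - trig_path y M t) <= e.
  have head_M h : (`|h| <= M)%N -> `|ST h w - y h| <= e / (1 + 2 * M%:R).
    by rewrite -ltnS MS; exact: head.
  by apply: le_trans (trig_path_dist head_M t01) _; rewrite divfK// gt_eqF.
have small_tail : 132 / (2 ^ m0)%:R <= e.
  by rewrite ler_pdivrMr ?ltr0n ?expn_gt0// mulrC -ler_pdivrMr.
have := fy' _ t01; rewrite normcC -(trig_path_truncate y' LM).
have := ler_distcD (trig_path y M t) (trig_path (ST^~ w) M t) (f t).
have := ler_distcD (trig_path (ST^~ w) M t) (trig_path (ST^~ w) N t) (f t).
have : eps = 4 * e by rewrite /e; field.
by move: pe tail_close head_close small_tail; move: (_.+1%:R^-1) (132 / _) => q r; lra.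
Qed.

End random_series.

Theorem theorem1p1 (d : measure_display) (T : measurableType d) (R : realType)
  (P : probability T R) (ST : int -> T -> R)
  (ST_meas : forall h, measurable_fun setT (ST h))
  (ST_indep : mutually_independent P ST)
  (ST_law : forall h, sato_tate_law P (ST h))
  (f : R -> R[i]) (f_cont : {within `[0%R, 1%R], continuous (f : R -> (R[i])^o)}) :
  in_support_K P ST f <->
  [/\ f 0 = 0,
      exists x : R, -2 <= x <= 2 /\ f 1 = x%:C
    & forall h : int, h != 0 ->
        let g := fun t : R => f t - t%:C * f 1 in
        complex.Re (fourier_coef g h) = 0 /\
        `|fourier_coef g h| <= ((pi * `|h|%:~R)^-1)%:C].
Proof.
split=> [supp|adm].
- exact/(admissibleP f_cont)/support_approximable.
- exact/approximable_support/(admissibleP f_cont).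
Qed.
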